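(* Let $\theta\in[0,\tfrac12)$ with $\sigma(\theta)$ periodic under $\sigma$, put $\theta'=\theta+\tfrac12$, and suppose that the critical diameter $\ell_\theta=\overline{\theta\theta'}$ generates a laminational snowflake of some depth. Then there does not exist a non-degenerate invariant lamination $\sim$ with $\theta\sim\theta'$.
   Context: $\mathbb{T}=\mathbb{R}/\mathbb{Z}$ is identified with the boundary of the closed unit disk $\mathbb{D}$; $\sigma(x)=2x\bmod1$; for $x\in\mathbb{T}$, $x'=x+\tfrac12$; $[x,y]$, $(x,y)$ are arcs running counterclockwise from $x$ to $y$. Laminations. Two closed sets $A,B\subset\mathbb{T}$ are unlinked if their convex hulls in $\mathbb{D}$ are disjoint. A lamination is a closed equivalence relation on $\mathbb{T}$ (closed graph) with nowhere dense classes such that distinct classes are unlinked. The degenerate lamination identifies all points. A lamination is invariant if $\sigma(C)$ is a class for every class $C$. Rotational orbit. A periodic orbit $E$ of $\sigma$ is rotational if $\sigma|_E$ is conjugate, by an orientation preserving homeomorphism of $\mathbb{T}$, to the restriction of a rigid rotation of $\mathbb{T}$ to the orbit of $0$. It is known (Bullett–Sentenac) that if $\theta\in[0,\tfrac12)$ is preperiodic then $[\theta,\theta']$ contains a unique rotational periodic orbit $A_\theta$. A critical diameter $\ell_\theta$ with $\theta\in[0,\frac12)$ and $\sigma(\theta)$ periodic is basic rotational if $\{\theta,\theta'\}\cap A_\theta\ne\emptyset$ (this includes $\theta=0$, where $A_0=\{0\}$). Canonic horseshoe and pruning. Let $\theta\in(0,\tfrac12)$ with $\sigma(\theta)$ periodic;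 then $A=A_\theta$ has period $k\ge2$ and $\mathbb{T}\setminus A$ has a unique component of length greater than $\tfrac12$; write it as $(\alpha',\beta)$ (counterclockwise, it contains $0$), and put $\alpha=\alpha'+\tfrac12$, $\beta'=\beta+\tfrac12$, $D=[\alpha,\beta]\cup[\alpha',\beta']$. The canonic traveling horseshoe is $D_\infty(A_\theta)=\{x:\sigma^{ki}(x)\in D\ \forall i\ge0\}$, a Cantor set. The canonic pruning $\varphi:\mathbb{T}\to\mathbb{T}$ is the orientation preserving monotone map which collapses the closure of each component of $\mathbb{T}\setminus D_\infty(A_\theta)$ to a point, maps $D_\infty(A_\theta)$ onto $\mathbb{T}$, satisfies $\varphi\circ\sigma^k=\sigma\circ\varphi$ on $D_\infty(A_\theta)$, and has $\varphi(\beta)=\varphi(\alpha')=0$, $\varphi(\alpha)=\varphi(\beta')=\tfrac12$. The diameter $\ell_\theta$ is basic non-rotational if $\{\theta,\theta'\}\cap D_\infty(A_\theta)=\emptyset$. Renormalization. If $\ell_\theta$ is neither basic rotational nor basic non-rotational, then $\{\theta,\theta'\}\subset D_\infty(A_\theta)\setminus A_\theta$, and the critical diameter with endpoints $\varphi(\theta)$ and $\varphi(\theta')=\varphi(\theta)+\tfrac12$, which again has periodic image $\sigma(\varphi(\theta))$ but of smaller period, is the rotational renormalization of $\ell_\theta$. Starting with $\ell_0=\ell_\theta$, let $\ell_{n+1}$ be the rotational renormalization of $\ell_n$ as long as $\ell_n$ is neither basic rotational nor basic non-rotational. The process terminates. If the last diameter obtained is basic rotational, one says that $\ell_\theta$ generates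 a laminational snowflake (its depth being determined by the number of steps). *)

(* Defs.v *)
From HB Require Import structures.
From mathcomp Require Import all_boot all_order all_algebra.
From mathcomp Require Import generic_quotient ring_quotient.
From mathcomp Require Import all_classical all_reals all_analysis.
Set Implicit Arguments.
Unset Strict Implicit.
Unset Printing Implicit Defensive.
Import Order.TTheory GRing.Theory Num.Theory.
Import numFieldNormedType.Exports.
Local Open Scope classical_set_scope.
Local Open Scope ring_scope.

(* The circle R/Z: the library's quotient of the additive group R by its
   subgroup of integers, with the quotient topology. *)
Definition RmodZ (R : realType) :=
  Quotient.quot (GRing.ZmodClosed.clone R (@Num.int_num_subdef R) _).

Definition circle (R : realType) : Type := quotient_topology (RmodZ R).

HB.instance Definition _ (R : realType) := Topological.on (circle R).
HB.instance Definition _ (R : realType) := Quotient.on (circle R).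
HB.instance Definition _ (R : realType) :=
  GRing.isZmodule.Build (circle R)
    (@Quotient.addqA R _) (@Quotient.addqC R _)
    (@Quotient.add0q R _) (@Quotient.addNq R _).

Section Circle.
Context {R : realType}.
Local Notation T := (circle R).
Implicit Types (x y z theta eta rho : T) (A B C E U : set T) (k n : nat).

Definition toT (t : R) : T := (\pi_(circle R) t)%qT.

(* the representative of x in [0, 1[ *)
Definition fracpart x : R := repr x - (Num.floor (repr x))%:~R.

Definition half_pt : T := toT 2^-1.
Definition antipode x : T := x + half_pt.
Definition sigma x : T := x *+ 2.

(* counterclockwise length from x to y, in [0, 1[; in particular it is 0 when
   x = y, so that arc_cc x x = [set x] and arc_oo x x = set0 *)
Definition arclen x y : R := fracpart (y - x).
Definition arc_cc x y : set T := [set z | arclen x z <= arclen x y].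
Definition arc_oo x y : set T := [set z | 0 < arclen x z < arclen x y].

Definition is_component C U := exists2 x, U x & C = connected_component U x.

(* Identification of R/Z with the boundary of the closed unit disk. *)
Definition disk_pt x : R^o * R^o :=
  (cos (2 * pi * fracpart x), sin (2 * pi * fracpart x)).

Definition convex_hull (S : set (convex_lmodType (R^o * R^o)%type)) :=
  smallest (@convex_set R (R^o * R^o)%type) S.

Definition unlinked A B :=
  convex_hull (disk_pt @` A) `&` convex_hull (disk_pt @` B) = set0.

(* A relation is given by lam : T -> set T, so that lam x is the class of x. *)
Definition is_lamination (lam : T -> set T) :=
  [/\ RelationClasses.Equivalence lam,
      closed [set p : T * T | lam p.1 p.2],
      forall x, interior (closure (lam x)) = set0 &
      forall x y, lam x <> lam y -> unlinked (lam x) (lam y)].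

Definition invariant_lamination (lam : T -> set T) :=
  forall x, exists y, sigma @` lam x = lam y.

Definition degenerate_lamination (lam : T -> set T) := forall x y, lam x y.

Definition periodic_pt x := exists2 k, (0 < k)%N & iter k sigma x = x.

Definition periodic_orbit k E :=
  exists x, [/\ (0 < k)%N, iter k sigma x = x,
    forall j, (0 < j < k)%N -> iter j sigma x <> x &
    E = [set iter i sigma x | i in [set: nat]]].

(* Monotone maps of degree one, defined by the existence of a continuous
   nondecreasing lift commuting with the translation by 1. *)
Definition op_monotone (f : T -> T) :=
  exists F : R -> R, [/\ continuous F, {homo F : s t / s <= t},
    forall t, F (t + 1) = F t + 1 & forall t, toT (F t) = f (toT t)].

Definition op_homeomorphism (h : T -> T) :=
  op_monotone h /\
  exists g : T -> T, [/\ cancel h g, cancel g h, continuous h & continuous g].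

Definition rotational_orbit k E :=
  periodic_orbit k E /\
  exists h rho, [/\ op_homeomorphism h,
    h @` E = [set rho *+ i | i in [set: nat]] &
    forall x, E x -> h (sigma x) = h x + rho].

(* A is the rotational orbit A_theta and k is its period. It is written as a
   relation; A_theta exists and is unique for every preperiodic theta in
   [0, 1/2[ (Bullett-Sentenac). *)
Definition is_A theta k A :=
  rotational_orbit k A /\ A `<=` arc_cc theta (antipode theta).

Definition basic_rotational theta :=
  exists k A, is_A theta k A /\ (A theta \/ A (antipode theta)).

(* k is the period of A_theta, and the open arc from a' to b is the component
   of length > 1/2 of the complement of A_theta (a' is the point alpha' and b
   the point beta) *)
Definition horseshoe_data theta k a' b :=
  theta <> 0 /\
  exists A, [/\ is_A theta k A, is_component (arc_oo a' b) (~` A) &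
                2^-1 < arclen a' b].

Definition horseshoe k a' b : set T :=
  [set x | forall i, (arc_cc (antipode a') b `|` arc_cc a' (antipode b))
                       (iter (k * i) sigma x)].

Definition is_pruning k a' b (phi : T -> T) :=
  let Dinf := horseshoe k a' b in
  [/\ op_monotone phi,
      forall C, is_component C (~` Dinf) ->
        forall x y, closure C x -> closure C y -> phi x = phi y,
      phi @` Dinf = [set: T],
      forall x, Dinf x -> phi (iter k sigma x) = sigma (phi x) &
      [/\ phi b = 0, phi a' = 0, phi (antipode a') = half_pt &
          phi (antipode b) = half_pt]].

Definition basic_nonrotational theta :=
  exists k a' b, [/\ horseshoe_data theta k a' b,
    ~ horseshoe k a' b theta & ~ horseshoe k a' b (antipode theta)].

(* eta is the endpoint in [0, 1/2[ of the renormalized diameter, the endpoints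
   of which are phi theta and phi (antipode theta) *)
Definition renormalization theta eta :=
  exists k a' b phi, [/\ horseshoe_data theta k a' b, is_pruning k a' b phi,
    fracpart eta < 2^-1 & eta = phi theta \/ eta = phi (antipode theta)].

(* The process started at theta stops after n renormalizations, at a basic
   rotational diameter. *)
Inductive snowflake : nat -> T -> Prop :=
| snowflake_basic theta : basic_rotational theta -> snowflake 0 theta
| snowflake_step n theta eta :
    ~ basic_rotational theta -> ~ basic_nonrotational theta ->
    renormalization theta eta -> snowflake n eta -> snowflake n.+1 theta.

End Circle.

(* Main.v *)
Require Import Defs.
From mathcomp Require Import all_boot all_order all_algebra.
From mathcomp Require Import generic_quotient ring_quotient.
From mathcomp Require Import all_classical all_reals all_analysis.
From mathcomp Require Import ring lra.

(** Everything is lifted from R/Z to R. A lamination that identifies the ends of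
the diameter at theta gives a relation e on R that is a closed Z-periodic
equivalence, is stable under doubling, and satisfies a pull-back rule: if s and t
lie in the same closed half of the circle cut by the diameter and 2s ~ 2t, then
s ~ t. Otherwise s ~ t + 1/2, and this chord would cross the diameter
([lamination_critical_relation], through [chords_cross]). The pull-back rule is
what remains of unlinkedness, and such a [critical_relation] passes to the
quotient by a pruning without any geometry. The result is therefore proved
for critical relations, by induction on the number of renormalizations: if theta
generates a snowflake, a critical relation at theta relates all points
([snowflake_total]).

Let (a, b) be the gap of length > 1/2 of the rotational orbit A of theta, of
period k, and c = 2^k. The gaps of A are permuted by the doubling map and double
in length along the orbit of gaps except at the long one, so that multiplication
by c maps each of [a, b - 1/2] and [a + 1/2, b] affinely onto [a, b] mod 1, the
intermediate iterates staying in the arc [b, a + 1], on one side of the diameter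
([gap_image], [gap_length], [gap_of_consecutive]). Hence relations can be pulled
back along k iterates at once. Pulling the diameter back by the branches at the
two ends of the gap gives related pairs that converge to (a, b), so a ~ b
([gap_ends_related]); passing from each point of A to the next one, all of A lies
in one class ([orbit_chain]). If a class contains p, p + 1/2 and 2p, the pull-back
rule makes it backward invariant, hence dense, and it is everything
([crel_total]).

When the diameter is basic rotational it ends in A, so the class of A contains
its end and the antipode of this end, and the relation is total. When the
diameter is renormalized by phi, its ends lie in the horseshoe, and the image
under phi of the relation on the horseshoe is again a critical relation, at
phi(theta) ([pruned_critical_relation]). The point is transitivity: each fibre of
phi in the horseshoe must lie in one class. Two points of such a fibre, modulo 1,
are either a and b or pulled back from b - 1/2 and a + 1/2, and both pairs are
related ([fibre_ind], [fibre_related]). By induction the image relation is total,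
so b ~ b + 1/2, and the class of A is everything. *)

Set Implicit Arguments.
Unset Strict Implicit.
Unset Printing Implicit Defensive.
Import Order.TTheory GRing.Theory Num.Theory.
Import numFieldNormedType.Exports.
Local Open Scope classical_set_scope.
Local Open Scope ring_scope.

(** * Congruence modulo 1 *)
Section Congruence.
Context {R : realType}.
Implicit Types s t u v : R.

Definition modZ s t : Prop := s - t \is a Num.int.

Lemma modZ_refl s : modZ s s.
Proof. by rewrite /modZ subrr rpred0. Qed.

Lemma modZ_sym s t : modZ s t -> modZ t s.
Proof. by rewrite /modZ -rpredN opprB. Qed.

Lemma modZ_trans s t u : modZ s t -> modZ t u -> modZ s u.
Proof.
move=> st tu; rewrite /modZ (_ : s - u = (s - t) + (t - u)); last by ring.
exact: rpredD.
Qed.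

Lemma modZD s t u v : modZ s t -> modZ u v -> modZ (s + u) (t + v).
Proof.
move=> st uv; rewrite /modZ (_ : s + u - (t + v) = (s - t) + (u - v)).
  exact: rpredD.
by ring.
Qed.


Lemma modZX n s t : modZ s t -> modZ (2 ^+ n * s) (2 ^+ n * t).
Proof.
by move=> st; rewrite /modZ -mulrBr; apply: rpredM => //; rewrite -natrX natr_int.
Qed.

Lemma modZ2 s t : modZ s t -> modZ (2 * s) (2 * t).
Proof. by move=> st; have := @modZX 1 _ _ st. Qed.

Lemma modZDint (m : int) s : modZ (s + m%:~R) s.
Proof. by rewrite /modZ addrC addKr intr_int. Qed.

Lemma modZP s t : modZ s t -> exists m : int, s = t + m%:~R.
Proof. by move=> /intrP[m /eqP]; rewrite subr_eq addrC => /eqP ->; exists m. Qed.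

Lemma modZ_fundamental v s : exists2 t, modZ t s & v <= t < v + 1.
Proof.
exists (s - (Num.floor (s - v))%:~R); first by rewrite -mulrNz; exact: modZDint.
have /andP[] := floor_itv (s - v); lra.
Qed.

Lemma modZ_eq s t : modZ s t -> - 1 < s - t < 1 -> s = t.
Proof.
move=> /modZP[m ->]; rewrite addrC addKr => m1.
have : (-1 < m < 1)%R by rewrite -!(ltr_int R) rmorphN.
by case: m {m1} => [[|[|n]]|[|n]] // _; rewrite addr0.
Qed.


Lemma modZ_diff1 s t : modZ t s -> s <= t <= s + 1 -> t = s \/ t = s + 1.
Proof.
move=> ts /andP[st ts1]; have [->|ne] := eqVneq t s; [by left|right].
apply: modZ_eq; first by apply: modZ_trans ts (modZ_sym _); exact: (modZDint 1).
have : s < t by rewrite lt_neqAle eq_sym ne.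
lra.
Qed.

(** The closed half circle that starts at u, as a Z-periodic subset of R. *)
Definition half_arc u s : Prop := exists2 t, modZ t s & u <= t <= u + 2^-1.

Lemma half_arc_modZ u s t : modZ s t -> half_arc u s -> half_arc u t.
Proof. by move=> st [r rs ur]; exists r => //; exact: modZ_trans rs st. Qed.

Lemma half_arc_mem u s : u <= s <= u + 2^-1 -> half_arc u s.
Proof. by move=> us; exists s => //; exact: modZ_refl. Qed.

Lemma half_arc_cover u s : half_arc u s \/ half_arc (u - 2^-1) s.
Proof.
have [t ts ut] := modZ_fundamental (u - 2^-1) s.
have [tu|ut'] := leP t u; [right|left]; exists t => //; lra.
Qed.

Lemma degree_one_int (F : R -> R) : (forall t, F (t + 1) = F t + 1) ->
  forall t (n : int), F (t + n%:~R) = F t + n%:~R.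
Proof.
move=> F1 t n.
have Fnat x (p : nat) : F (x + p%:R) = F x + p%:R.
  elim: p => [|p IH]; first by rewrite !addr0.
  by rewrite -natr1 !addrA F1 IH.
case: n => p; first exact: Fnat.
rewrite NegzE mulrNz; apply: (addIr p.+1%:R).
by rewrite -Fnat -!addrA addNr !addr0.
Qed.

End Congruence.

(** * Critical relations *)
Section CriticalRelation.
Context {R : realType}.
Implicit Types (s t u v theta a b : R) (e : R -> R -> Prop) (k n : nat).

(** The two values of u in [crel_pull] are the starting points of the two closed
half circles bounded by the diameter at theta. *)
Record critical_relation theta e : Prop := CriticalRelation {
  crel_modZ : forall s t, modZ s t -> e s t;
  crel_sym : forall s t, e s t -> e t s;
  crel_trans : forall s t u, e s t -> e t u -> e s u;
  crel_closed : closed [set p : R * R | e p.1 p.2];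
  crel_double : forall s t, e s t -> e (2 * s) (2 * t);
  crel_diam : e theta (theta - 2^-1);
  crel_pull : forall u s t, u = theta \/ u = theta - 2^-1 ->
    half_arc u s -> half_arc u t -> e (2 * s) (2 * t) -> e s t }.

Lemma half_arc_shift1 u s : half_arc (u + 1) s -> half_arc u s.
Proof.
move=> [t ts ut]; exists (t - 1); last by lra.
by apply: modZ_trans ts; exact: (modZDint (-1)).
Qed.

(** A diameter has two ends, and theta stands for either of them; this matters
because the renormalized diameter is named by the end in [0, 1/2). *)
Lemma crel_antipode theta e :
  critical_relation theta e -> critical_relation (theta + 2^-1) e.
Proof.
move=> E; have [Em Es Et Ec E2 Ed Ep] := E; split=> //.
- apply: (Et _ (theta - 2^-1)); last by rewrite addrK; exact/Es.
  apply: Em; rewrite /modZ (_ : _ - _ = 1) ?int_num1//; lra.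
- move=> u s t [->|->]; last by rewrite addrK; apply: Ep; left.
  move=> us ut; apply: (Ep (theta - 2^-1)); first by right.
  + by apply: half_arc_shift1; rewrite (_ : _ + 1 = theta + 2^-1) //; lra.
  + by apply: half_arc_shift1; rewrite (_ : _ + 1 = theta + 2^-1) //; lra.
Qed.

Lemma crel_limit theta e (u v : nat -> R) s t : critical_relation theta e ->
  (forall n, e (u n) (v n)) -> u @ \oo --> s -> v @ \oo --> t -> e s t.
Proof.
move=> E uv us vt.
have c := crel_closed E.
apply: (closed_cvg (u_ := fun n => (u n, v n)) (F := \oo) _ c _ (s, t)).
  by apply: nearW => n; exact: uv.
exact: (cvg_pair us vt).
Qed.

Lemma cvg_geometric_shift (c d : R) (m : nat) : (0 < m)%N ->
  (fun n => c + d / (2 ^+ m) ^+ n) @ \oo --> c.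
Proof.
move=> m0; rewrite -[X in _ --> X]addr0; apply: cvgD; first exact: cvg_cst.
rewrite (_ : (fun n => _) = geometric d ((2 ^+ m)^-1)); last first.
  by apply/funext => n; rewrite /geometric /= exprVn.
apply: cvg_geometric; rewrite ger0_norm ?invr_ge0 ?exprn_ge0//.
by rewrite invf_lt1 ?exprn_gt0// exprn_egt1 ?ltr1n//; case: m m0.
Qed.

(** One of p, p - 1/2 lies in the same closed half circle as a given s, and both
are mapped to 2p ~ p; so s ~ p as soon as 2s ~ p. The class of p thus contains
every point with an iterate p mod 1; these are dense. *)
Lemma crel_total theta e p : critical_relation theta e ->
  e p (p - 2^-1) -> e (2 * p) p -> forall s t, e s t.
Proof.
move=> E pp' p2p; have [Em Es Et _ E2 _ Ep] := E.
have back s : e (2 * s) p -> e s p.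
  move=> s2p.
  have key u : u = theta \/ u = theta - 2^-1 -> half_arc u s ->
      half_arc u p \/ half_arc u (p - 2^-1) -> e s p.
    move=> hu us [up|up].
      by apply: (Ep _ _ _ hu us up); apply: (Et _ _ _ s2p); exact/Es.
    apply: (Et _ (p - 2^-1)); last exact/Es.
    apply: (Ep _ _ _ hu us up); apply: (Et _ _ _ s2p).
    by apply: (Et _ (2 * p)); [exact/Es|exact/E2].
  have anti u : half_arc u p \/ half_arc u (p - 2^-1).
    have [|[t tp up]] := half_arc_cover u p; [by left|right].
    exists (t + 2^-1); last by lra.
    rewrite /modZ (_ : _ - _ = (t - p) + 1); last by lra.
    by apply: rpredD => //; exact: int_num1.
  have [us|us] := half_arc_cover theta s.
  - by apply: (key theta) => //; left.
  - by apply: (key (theta - 2^-1)) => //; right.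
suff all s : e s p by move=> s t; apply: (Et _ p) => //; exact/Es.
(* v n is within 1 / 2^n of s, and 2^n (v n) = 2^n p mod 1, which is related to p. *)
pose v n := p + (Num.floor (2 ^+ n * (s - p)))%:~R / 2 ^+ n.
have vp n : e (v n) p.
  have : e (2 ^+ n * v n) p.
    rewrite /v mulrDr mulrCA divff ?mulr1 ?expf_neq0 ?pnatr_eq0//.
    apply: (Et _ (2 ^+ n * p)); first exact/Em/modZDint.
    elim: n => [|n IH]; first by rewrite expr0 mul1r; exact/Em/modZ_refl.
    rewrite exprS -mulrA; apply: (Et _ (2 * p)) => //; exact: E2.
  elim: n (v n) => [|n IH] w; first by rewrite expr0 mul1r.
  by rewrite exprSr -mulrA => /IH; exact: back.
apply: (@crel_limit theta e v (fun=> p)) => //; last exact: cvg_cst.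
have lim := @cvg_geometric_shift s 1 1 isT.
have lim' := @cvg_geometric_shift s (-1) 1 isT.
apply: (squeeze_cvgr _ lim' lim); apply: nearW => n.
rewrite expr1 /v.
have /andP[] := floor_itv (2 ^+ n * (s - p)).
have P : 0 < 2 ^+ n :> R by rewrite exprn_gt0.
have q0 : 0 < (2 ^+ n)^-1 :> R by rewrite invr_gt0.
have qP : (2 ^+ n)^-1 * 2 ^+ n = 1 :> R by rewrite mulVf ?gt_eqF.
move: (Num.floor _) => m; rewrite intrD -(ler_pM2l q0) -(ltr_pM2l q0) mulrA qP !mul1r mulrDr mulr1z mulr1.
move=> l r; rewrite [X in p + X]mulrC; lra.
Qed.

End CriticalRelation.

(** * The long gap of a rotational orbit and its horseshoe *)
Section RotationalGap.
Context {R : realType}.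
Implicit Types (s t u v theta a b : R) (e : R -> R -> Prop) (k n : nat).

(** What is used of the rotational orbit A of theta, in lifted form. The interval
(a, b) is the gap of length > 1/2, lifted so that b and a + 1/2 are on either side
of theta. By [gap_expand], 2^k maps each of [a, b - 1/2] and [a + 1/2, b] onto
[a, b] mod 1; by [gap_transit], the iterates in between run through the arc
[b, a + 1], which contains A. [gap_chain] is the transitivity of the cyclic
successor on A. *)
Record rotational_gap theta a b k : Prop := RotationalGap {
  gap_period : (0 < k)%N;
  gap_diam : a + 2^-1 <= theta <= b;
  gap_short : b - a < 1;
  gap_long : 2^-1 < b - a;
  gap_expand : 2 ^+ k * (b - a - 2^-1) = b - a;
  gap_fix_left : modZ (2 ^+ k * a) a;
  gap_fix_right : modZ (2 ^+ k * b) b;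
  gap_transit : forall i t, (0 < i < k)%N -> a <= t <= b - 2^-1 ->
    exists2 s, modZ s (2 ^+ i * t) & b <= s <= a + 1;
  gap_chain : forall e, critical_relation theta e -> e a b -> e (2 * b) b }.

Context (theta a b : R) (k : nat) (G : rotational_gap theta a b k).
Local Notation c := (2 ^+ k : R).

Definition in_branches t := a <= t <= b - 2^-1 \/ a + 2^-1 <= t <= b.

Lemma gap_bounds :
  [/\ a + 2^-1 <= theta, theta <= b, b - a < 1 & 2^-1 < b - a].
Proof.
have /andP[h1 h2] := gap_diam G.
by split=> //; [exact: gap_short G|exact: gap_long G].
Qed.

Lemma expansion_gt1 : 1 < c.
Proof. by rewrite exprn_egt1 ?ltr1n//; case: k G => -[]. Qed.

Lemma doubling_shift_half i t : (0 < i)%N -> modZ (2 ^+ i * (t + 2^-1)) (2 ^+ i * t).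
Proof.
case: i => // i _; rewrite /modZ exprS.
rewrite (_ : _ - _ = 2 ^+ i); first by rewrite -natrX natr_int.
by move: (2 ^+ i) => z; lra.
Qed.

Lemma expansion_inv n : 0 < (c ^+ n)^-1 <= 1.
Proof.
have c1 : 1 <= c ^+ n by rewrite exprn_ege1// ltW// expansion_gt1.
have c0 : 0 < c ^+ n by exact: lt_le_trans c1.
by rewrite invr_gt0 c0 invf_le1.
Qed.

Lemma expand_left t : modZ (c * t) (a + c * (t - a)).
Proof.
rewrite /modZ (_ : _ - _ = c * a - a); first exact: gap_fix_left G.
by move: (c) => z; ring.
Qed.

Lemma expand_right t : modZ (c * t) (b - c * (b - t)).
Proof.
rewrite /modZ (_ : _ - _ = c * b - b); first exact: gap_fix_right G.
by move: (c) => z; ring.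
Qed.

Lemma transit_half_arc i t : (0 < i < k)%N -> in_branches t ->
  half_arc theta (2 ^+ i * t).
Proof.
move=> ik tb.
have [h1 h2 h3 h4] := gap_bounds.
have [t' at' tt'] : exists2 t', a <= t' <= b - 2^-1 &
    modZ (2 ^+ i * t') (2 ^+ i * t).
  case: tb => tb; first by exists t => //; exact: modZ_refl.
  exists (t - 2^-1); first by lra.
  rewrite -[X in modZ _ (_ * X)](subrK 2^-1 t); apply: modZ_sym.
  by apply: doubling_shift_half; case/andP: ik.
have [s s1 s2] := gap_transit G ik at'.
exists s; first exact: (modZ_trans s1 tt'). lra.
Qed.

Section Relation.
Context (e : R -> R -> Prop) (E : critical_relation theta e).

(** The intermediate iterates lie in the half circle that contains A, so that the
pull-back rule applies at every step; the side of the diameter only has to be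
known for s and t themselves. *)
Lemma pull_back_period u s t : u = theta \/ u = theta - 2^-1 ->
  in_branches s -> in_branches t -> half_arc u s -> half_arc u t ->
  e (c * s) (c * t) -> e s t.
Proof.
move=> hu bs bt us ut est.
suff pull j : (j < k)%N -> e (2 ^+ j.+1 * s) (2 ^+ j.+1 * t) -> e s t.
  have k0 := gap_period G.
  by apply: (pull k.-1); rewrite prednK.
elim: j => [_|j IH jk ej]; first by rewrite expr1; exact: (crel_pull E hu us ut).
apply: IH; first exact: ltnW.
apply: (crel_pull E (or_introl erefl)); rewrite ?mulrA -?exprS//;
  by apply: transit_half_arc.
Qed.

Lemma expansion_cancel n z : c * (z / c ^+ n.+1) = z / c ^+ n.
Proof.
have c0 : c != 0 by rewrite expf_neq0 ?pnatr_eq0.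
by rewrite mulrCA; congr (_ * _); rewrite exprS invfM mulrA divff ?mul1r.
Qed.

(** The diameter joins [a, b - 1/2] to [a + 1/2, b]. Its end in the first interval
is pulled back towards the fixed point a, the other one towards the fixed point b,
and the pairs obtained remain on the side of the diameter that contains A. *)
Lemma gap_ends_related : e a b.
Proof.
have [h1 h2 h3 h4] := gap_bounds.
pose u n := a + (theta - 2^-1 - a) / c ^+ n.
pose v n := b + (theta - b) / c ^+ n.
have cn := expansion_inv.
have un n : a <= u n <= theta - 2^-1.
  have := cn n; rewrite /u; nra.
have vn n : theta <= v n <= b.
  have := cn n; rewrite /v; nra.
apply: (@crel_limit _ theta e u v); [done| |exact: cvg_geometric_shift (gap_period G)
   |exact: cvg_geometric_shift (gap_period G)].
elim=> [|n IH].
  have -> : u 0%N = theta - 2^-1 by rewrite /u expr0 divr1; ring.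
  have -> : v 0%N = theta by rewrite /v expr0 divr1; ring.
  exact/(crel_sym E)/(crel_diam E).
have un1 := un n.+1; have vn1 := vn n.+1.
apply: (pull_back_period (or_introl erefl)).
- by left; lra.
- by right; lra.
- exists (u n.+1 + 1); [exact: (modZDint 1)|lra].
- by exists (v n.+1); [exact: modZ_refl|lra].
- apply: (crel_trans E (t := u n)).
    apply: (crel_modZ E); apply: modZ_trans (expand_left _) _.
    by rewrite /u addrAC subrr add0r expansion_cancel; exact: modZ_refl.
  apply: (crel_trans E IH).
  apply: (crel_modZ E); apply: modZ_sym; apply: modZ_trans (expand_right _) _.
  rewrite /v opprD addrA subrr add0r mulrN expansion_cancel opprK.
  exact: modZ_refl.
Qed.

Lemma orbit_related : e (2 * b) b.
Proof. exact: (gap_chain G E gap_ends_related). Qed.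

(** Both points lie in the half circle opposite to A, and they are mapped to 2b and
2a, where a ~ b. *)
Lemma antipodal_gap_ends_related : e (b - 2^-1) (a + 2^-1).
Proof.
have [h1 h2 h3 h4] := gap_bounds.
apply: (crel_pull E (or_intror erefl)).
- by apply: half_arc_mem; lra.
- by apply: half_arc_mem; lra.
apply: (crel_trans E (t := 2 * b)).
  by apply: (crel_modZ E); rewrite /modZ (_ : _ - _ = - 1) ?rpredN ?int_num1//; lra.
apply: (crel_trans E (t := 2 * a)).
  exact/(crel_sym E)/(crel_double E)/gap_ends_related.
by apply: (crel_modZ E); rewrite /modZ (_ : _ - _ = - 1) ?rpredN ?int_num1//; lra.
Qed.

Lemma gap_total : e b (b - 2^-1) -> forall s t, e s t.
Proof. by move=> ebb; apply: (crel_total E ebb orbit_related). Qed.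

Lemma gap_total_end : theta = b \/ theta = a + 2^-1 -> forall s t, e s t.
Proof.
move=> h; apply: gap_total; have ed := crel_diam E; case: h => h.
  by rewrite -h.
rewrite h addrK in ed.
have E1 := gap_ends_related; have E2 := antipodal_gap_ends_related.
apply: (crel_trans E (crel_sym E E1)); apply: (crel_trans E (crel_sym E ed)).
exact: crel_sym E _ _ E2.
Qed.

End Relation.

(** The condition that the iterates under 2^k remain in the two branches is
expressed by avoiding the two complementary open arcs, which makes the set visibly
closed. *)
Definition in_horseshoe t := forall i r, modZ r (2 ^+ (k * i) * t) ->
  ~ (b - 2^-1 < r < a + 2^-1) /\ ~ (b < r < a + 1).

Lemma in_horseshoe_modZ s t : modZ s t -> in_horseshoe s -> in_horseshoe t.
Proof.
move=> st Ds i r rt; apply: (Ds i); apply: modZ_trans rt _.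
exact/modZ_sym/modZX.
Qed.

Lemma in_horseshoe_expand t : in_horseshoe t -> in_horseshoe (c * t).
Proof.
move=> Dt i r rt; apply: (Dt i.+1).
by rewrite mulnS addnC exprD -mulrA.
Qed.

Lemma in_horseshoe_gaps s t : in_horseshoe t -> modZ s t ->
  ~ (b - 2^-1 < s < a + 2^-1) /\ ~ (b < s < a + 1).
Proof. by move=> Dt st; apply: (Dt 0%N); rewrite muln0 expr0 mul1r. Qed.

Lemma in_horseshoe_branches t : in_horseshoe t -> a <= t <= b -> in_branches t.
Proof.
move=> /in_horseshoe_gaps/(_ (modZ_refl t))[h _] atb.
have [tb|tb] := leP t (b - 2^-1); first by left; lra.
have [ta|ta] := leP (a + 2^-1) t; first by right; lra.
by case: h; lra.
Qed.

Lemma in_horseshoe_lift t : in_horseshoe t -> exists2 s, modZ s t & a <= s <= b.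
Proof.
move=> Dt; have [s st as1] := modZ_fundamental a t; exists s => //.
have [_ nbs] := in_horseshoe_gaps Dt st.
by have [|bs] := leP s b; [lra|case: nbs; lra].
Qed.

Lemma in_branches_gaps r s : in_branches s -> modZ r s ->
  ~ (b - 2^-1 < r < a + 2^-1) /\ ~ (b < r < a + 1).
Proof.
have [h1 h2 h3 h4] := gap_bounds.
move=> sb rs; split=> h.
- have ers : r = s by apply: (modZ_eq rs); case: sb; lra.
  by rewrite ers in h; case: sb; lra.
- have ers : r = s by apply: (modZ_eq rs); case: sb; lra.
  by rewrite ers in h; case: sb; lra.
Qed.

Lemma in_horseshoe_step t : in_branches t -> in_horseshoe (c * t) -> in_horseshoe t.
Proof.
move=> tb Dt [|i] r; first by rewrite muln0 expr0 mul1r; exact: in_branches_gaps.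
by rewrite mulnS addnC exprD -mulrA => /Dt.
Qed.

Lemma in_horseshoe_fixed t : in_branches t -> modZ (c * t) t -> in_horseshoe t.
Proof.
move=> tb ct i r rt; apply: (in_branches_gaps tb); apply: modZ_trans rt _.
elim: i => [|i IH]; first by rewrite muln0 expr0 mul1r; exact: modZ_refl.
by rewrite mulnS addnC exprD -mulrA; apply: modZ_trans IH; exact: modZX.
Qed.

Lemma closed_in_horseshoe : closed [set t | in_horseshoe t].
Proof.
rewrite (_ : [set t | in_horseshoe t] = \bigcap_(i in [set: nat])
   \bigcap_(m in [set: int]) ([set t | ~ (b - 2^-1 < 2 ^+ (k * i) * t + m%:~R < a + 2^-1)]
     `&` [set t | ~ (b < 2 ^+ (k * i) * t + m%:~R < a + 1)])).
  apply: closed_bigI => i _; apply: closed_bigI => m _.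
  pose f t := 2 ^+ (k * i) * t + m%:~R.
  have cf : continuous f.
    move=> t; apply: cvgD; last exact: cvg_cst.
    by apply: cvgM; [exact: cvg_cst|exact: cvg_id].
  have cl x y : closed [set t | ~ (x < f t < y)].
    rewrite (_ : [set t | _] = f @^-1` (~` `]x, y[%classic)).
      by apply: preimage_closed => // ; exact: open_closedC.
    by apply/seteqP; split=> t /=; rewrite in_itv.
  by apply: closedI; exact: cl.
apply/seteqP; split=> t /= Dt.
  by move=> i _ m _; apply: (Dt i); exact: modZDint.
by move=> i r /modZP[m ->]; exact: (Dt i I m I).
Qed.

End RotationalGap.

(** * Fibres of a pruning on the horseshoe *)
Section PruningLift.
Context {R : realType}.
Implicit Types (s t u v x y z : R) (e : R -> R -> Prop) (n : nat).
Context (theta a b : R) (k : nat) (G : rotational_gap theta a b k).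
Local Notation c := (2 ^+ k : R).
Local Notation hs := (in_horseshoe a b k).

(** F lifts the pruning to R. [plift_expand] is the semiconjugacy with the doubling
map. *)
Record pruning_lift (F : R -> R) : Prop := PruningLift {
  plift_cont : continuous F;
  plift_homo : {homo F : s t / s <= t};
  plift_degree : forall t, F (t + 1) = F t + 1;
  plift_left : F a \is a Num.int;
  plift_right : F b \is a Num.int;
  plift_left_half : modZ (F (a + 2^-1)) 2^-1;
  plift_right_half : modZ (F (b - 2^-1)) 2^-1;
  plift_expand : forall t, hs t -> modZ (F (c * t)) (2 * F t);
  plift_onto : forall s, exists2 t, hs t & F t = s }.

Context (F : R -> R) (PF : pruning_lift F).

Lemma plift_int t (n : int) : F (t + n%:~R) = F t + n%:~R.
Proof.
exact: degree_one_int (plift_degree PF) t n.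
Qed.

Lemma plift_modZ s t : modZ s t -> modZ (F s) (F t).
Proof. by move=> /modZP[n ->]; rewrite plift_int; exact: modZDint. Qed.

Lemma plift_left_antipode : F (a + 2^-1) = F a + 2^-1.
Proof.
apply: modZ_eq.
  apply: modZ_trans (plift_left_half PF) _.
  by rewrite /modZ opprD addrCA subrr addr0 rpredN (plift_left PF).
have F1 : F a <= F (a + 2^-1) by apply: (plift_homo PF); lra.
have F2 : F (a + 2^-1) <= F (a + 1) by apply: (plift_homo PF); lra.
by rewrite (plift_degree PF) in F2; lra.
Qed.

Lemma plift_right_end : F b = F a + 1.
Proof.
have [h1 h2 h3 h4] := gap_bounds G.
apply: modZ_eq.
  by apply: rpredB; rewrite ?rpredD ?int_num1 ?(plift_left PF) ?(plift_right PF).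
have F1 : F (a + 2^-1) <= F b by apply: (plift_homo PF); lra.
have F2 : F b <= F (a + 1) by apply: (plift_homo PF); lra.
by rewrite (plift_degree PF) in F2; rewrite plift_left_antipode in F1; lra.
Qed.

Lemma plift_right_antipode : F (b - 2^-1) = F a + 2^-1.
Proof.
have [h1 h2 h3 h4] := gap_bounds G.
apply: modZ_eq.
  apply: modZ_trans (plift_right_half PF) _.
  by rewrite /modZ opprD addrCA subrr addr0 rpredN (plift_left PF).
have F1 : F a <= F (b - 2^-1) by apply: (plift_homo PF); lra.
have F2 : F (b - 2^-1) <= F (a + 1) by apply: (plift_homo PF); lra.
by rewrite (plift_degree PF) in F2; lra.
Qed.

Lemma half_notin_int : (2^-1 : R) \is a Num.int = false.
Proof.
apply/negP => h.
have : (2^-1 : R) = 0 by apply: modZ_eq; [rewrite /modZ subr0|lra].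
lra.
Qed.

Lemma in_horseshoe_left_end : hs a.
Proof.
have [h1 h2 h3 h4] := gap_bounds G.
by apply: (in_horseshoe_fixed G); [left; lra|exact: gap_fix_left G].
Qed.

Lemma in_horseshoe_right_end : hs b.
Proof.
have [h1 h2 h3 h4] := gap_bounds G.
by apply: (in_horseshoe_fixed G); [right; lra|exact: gap_fix_right G].
Qed.

Lemma in_horseshoe_antipode s t : in_branches a b t -> hs s -> s = t + 2^-1 \/ t = s + 2^-1 -> hs t.
Proof.
move=> tb Ds st; apply: (in_horseshoe_step G tb).
apply: in_horseshoe_modZ (in_horseshoe_expand Ds).
have k0 := gap_period G.
case: st => ->; first exact: doubling_shift_half.
by apply: modZ_sym; exact: doubling_shift_half.
Qed.

Lemma double_half t : F t = F a + 2^-1 -> 2 * F t \is a Num.int.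
Proof.
move=> ->; rewrite mulrDr divff ?pnatr_eq0// rpredD ?int_num1//.
by rewrite rpredM ?(plift_left PF)// (natr_int _ 2).
Qed.

(** On the horseshoe F (c s) = 2 F s mod 1. *)
Lemma plift_expand_int s t : hs s -> modZ (c * s) t -> 2 * F s \is a Num.int ->
  F t \is a Num.int.
Proof.
move=> Ds st F2; have : modZ (F t) (2 * F s).
  by apply: modZ_trans (plift_expand PF Ds); apply: modZ_sym; exact: plift_modZ.
by rewrite /modZ => h; rewrite -(subrK (2 * F s) (F t)) rpredD.
Qed.

Lemma plift_expand_notin_int s t : hs s -> modZ t (c * s) ->
  F t \isn't a Num.int -> F s \isn't a Num.int.
Proof.
move=> Ds ts; apply: contra => Fs; apply: (plift_expand_int Ds (modZ_sym ts)).
by rewrite rpredM// (natr_int _ 2).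
Qed.

(** The successive preimages w n of b - 1/2 under the left branch decrease to a. An
iterate of w n is b - 1/2, where F takes the value 1/2 mod 1, while doubling maps
integers to integers; hence F (w n) is not an integer, and F > F a beyond a. *)
Lemma plift_fibre_left x : a <= x -> F x = F a -> x = a.
Proof.
move=> ax Fx; apply/eqP; rewrite eq_le ax andbT leNgt; apply/negP => ltax.
have [h1 h2 h3 h4] := gap_bounds G.
pose w n := a + (b - 2^-1 - a) / c ^+ n.
have wa n : a <= w n <= b - 2^-1.
  have /andP[] := expansion_inv G n; rewrite /w; nra.
have wE n : modZ (w n) (c * w n.+1).
  apply: modZ_sym; apply: modZ_trans (expand_left G _) _.
  by rewrite /w addrAC subrr add0r expansion_cancel; exact: modZ_refl.
have w0 : w 0%N = b - 2^-1 by rewrite /w expr0 divr1; ring.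
have Dw n : hs (w n).
  elim: n => [|n IH].
    rewrite w0; apply: (in_horseshoe_antipode (s := b)); first by left; lra.
      exact: in_horseshoe_right_end.
    by left; rewrite subrK.
  apply: (in_horseshoe_step G); first by left; exact: wa.
  exact: in_horseshoe_modZ (wE n) IH.
have Fw n : F (w n) \isn't a Num.int.
  elim: n => [|n]; last exact: plift_expand_notin_int (Dw n.+1) (wE n).
  rewrite w0 plift_right_antipode rpredDl ?(plift_left PF)//.
  by rewrite half_notin_int.
have [n] : exists n, w n < x.
  have lim := @cvg_geometric_shift _ a (b - 2^-1 - a) k (gap_period G).
  by have [n wn] := filter_ex (cvgr_lt _ lim _ ltax); exists n.
move=> wx; have F1 : F (w n) <= F x by apply: (plift_homo PF); exact: ltW.
have F2 : F a <= F (w n) by apply: (plift_homo PF); have := wa n; lra.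
have FF : F (w n) = F a by lra.
by have := Fw n; rewrite FF (plift_left PF).
Qed.

Lemma plift_fibre_right x : x <= b -> F x = F b -> x = b.
Proof.
move=> ax Fx; apply/eqP; rewrite eq_le ax /= leNgt; apply/negP => ltax.
have [h1 h2 h3 h4] := gap_bounds G.
pose w n := b + (a + 2^-1 - b) / c ^+ n.
have wa n : a + 2^-1 <= w n <= b.
  have /andP[] := expansion_inv G n; rewrite /w; nra.
have wE n : modZ (w n) (c * w n.+1).
  apply: modZ_sym; apply: modZ_trans (expand_right G _) _.
  rewrite /w opprD addrA subrr add0r mulrN expansion_cancel opprK.
  exact: modZ_refl.
have w0 : w 0%N = a + 2^-1 by rewrite /w expr0 divr1; ring.
have Dw n : hs (w n).
  elim: n => [|n IH].
    rewrite w0; apply: (in_horseshoe_antipode (s := a)); first by right; lra.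
      exact: in_horseshoe_left_end.
    by right.
  apply: (in_horseshoe_step G); first by right; exact: wa.
  exact: in_horseshoe_modZ (wE n) IH.
have Fw n : F (w n) \isn't a Num.int.
  elim: n => [|n]; last exact: plift_expand_notin_int (Dw n.+1) (wE n).
  rewrite w0 plift_left_antipode rpredDl ?(plift_left PF)//.
  by rewrite half_notin_int.
have [n] : exists n, x < w n.
  have lim := @cvg_geometric_shift _ b (a + 2^-1 - b) k (gap_period G).
  by have [n wn] := filter_ex (cvgr_gt _ lim _ ltax); exists n.
move=> wx; have F1 : F x <= F (w n) by apply: (plift_homo PF); exact: ltW.
have F2 : F (w n) <= F b by apply: (plift_homo PF); have := wa n; lra.
have FF : F (w n) = F b by lra.
by have := Fw n; rewrite FF (plift_right PF).
Qed.

Local Notation expL t := (a + c * (t - a)).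
Local Notation expR t := (b - c * (b - t)).

Lemma expL_itv t : a <= t <= b - 2^-1 -> a <= expL t <= b.
Proof.
have := gap_expand G; have := expansion_gt1 G; move: (c) => z; nra.
Qed.

Lemma expR_itv t : a + 2^-1 <= t <= b -> a <= expR t <= b.
Proof.
have := gap_expand G; have := expansion_gt1 G; move: (c) => z; nra.
Qed.

Lemma expL_eq_right t : expL t = b -> t = b - 2^-1.
Proof.
have := gap_expand G; have := expansion_gt1 G; move: (c) => z.
move=> z1 h tb; apply: (@mulfI _ z); first by rewrite gt_eqF//; lra.
lra.
Qed.

Lemma expL_eq_left t : expL t = a -> t = a.
Proof.
have := expansion_gt1 G; move: (c) => z.
move=> z1 tb; apply: (@mulfI _ z); first by rewrite gt_eqF//; lra.
lra.
Qed.

Lemma expR_eq_left t : expR t = a -> t = a + 2^-1.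
Proof.
have := gap_expand G; have := expansion_gt1 G; move: (c) => z.
move=> z1 h tb; apply: (@mulfI _ z); first by rewrite gt_eqF//; lra.
lra.
Qed.

Lemma expR_eq_right t : expR t = b -> t = b.
Proof.
have := expansion_gt1 G; move: (c) => z.
move=> z1 tb; apply: (@mulfI _ z); first by rewrite gt_eqF//; lra.
lra.
Qed.

Lemma plift_itv t : a <= t <= b -> F a <= F t <= F a + 1.
Proof.
move=> /andP[at_ tb].
by rewrite (plift_homo PF at_) -plift_right_end (plift_homo PF tb).
Qed.

Lemma plift_int_ends t : a <= t <= b -> F t \is a Num.int -> t = a \/ t = b.
Proof.
move=> /[dup] tab /plift_itv Ft Fint.
case: (@modZ_diff1 _ (F a) (F t)) => //.
- by rewrite /modZ rpredB ?(plift_left PF).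
- by move=> h; left; apply: plift_fibre_left => //; lra.
- rewrite -plift_right_end => h; right; apply: plift_fibre_right => //; lra.
Qed.

(** One iterate sends x to a point where F is an integer, that is, to an end of the
gap. *)
Lemma plift_fibre_left_antipode x : a <= x <= b - 2^-1 -> hs x -> F x = F a + 2^-1 ->
  x = b - 2^-1.
Proof.
move=> xab Dx Fx.
have Fy := plift_expand_int Dx (expand_left G x) (double_half Fx).
case: (plift_int_ends (expL_itv xab) Fy) => h; last exact: expL_eq_right.
by move: Fx; rewrite (expL_eq_left h); lra.
Qed.

Lemma plift_fibre_right_antipode x : a + 2^-1 <= x <= b -> hs x -> F x = F a + 2^-1 ->
  x = a + 2^-1.
Proof.
move=> xab Dx Fx.
have Fy := plift_expand_int Dx (expand_right G x) (double_half Fx).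
case: (plift_int_ends (expR_itv xab) Fy) => h; first exact: expR_eq_left.
by move: Fx; rewrite (expR_eq_right h) plift_right_end; lra.
Qed.

Lemma in_horseshoe_expL t : hs t -> hs (expL t).
Proof. by move=> /in_horseshoe_expand; exact/in_horseshoe_modZ/expand_left/G. Qed.

Lemma in_horseshoe_expR t : hs t -> hs (expR t).
Proof. by move=> /in_horseshoe_expand; exact/in_horseshoe_modZ/expand_right/G. Qed.

(** After one iterate, the values of F at two points of a fibre agree mod 1, and so
they agree unless they are the extreme values on [a, b]. *)
Lemma plift_expand_eq f x y : (forall t, modZ (c * t) (f t)) ->
  hs x -> hs y -> F x = F y -> a <= f x -> f x <= f y -> f y <= b ->
  F (f x) = F (f y) \/ f x = a /\ f y = b.
Proof.
move=> fE Dx Dy Fxy afx fxy fyb.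
have modf t : hs t -> modZ (F (f t)) (2 * F t).
  move=> Dt; apply: modZ_trans (plift_expand PF Dt).
  exact/plift_modZ/modZ_sym/fE.
have FF : modZ (F (f y)) (F (f x)).
  by apply: modZ_trans (modf _ Dy) (modZ_sym _); rewrite -Fxy; exact: modf.
have /andP[fx1 fx2] : F a <= F (f x) <= F a + 1 by apply: plift_itv; lra.
have /andP[fy1 fy2] : F a <= F (f y) <= F a + 1 by apply: plift_itv; lra.
have Fle := plift_homo PF fxy.
have Fb := plift_right_end.
case: (modZ_diff1 FF) => [|->|h]; [lra|by left|right; split].
- by apply: plift_fibre_left; lra.
- by apply: plift_fibre_right; lra.
Qed.

(** Two points of a fibre in the same branch are sent by this branch to two points
of a fibre that are c times farther apart. This stops when the points are in
different branches, where F <= F a + 1/2 and F >= F a + 1/2 respectively; they are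
then b - 1/2 and a + 1/2. *)
Lemma fibre_ind (P : R -> R -> Prop) :
  P (b - 2^-1) (a + 2^-1) ->
  (forall x y, hs x -> hs y -> a <= x -> x < y -> y <= b - 2^-1 -> F x = F y ->
     P (expL x) (expL y) -> P x y) ->
  (forall x y, hs x -> hs y -> a + 2^-1 <= x -> x < y -> y <= b -> F x = F y ->
     P (expR x) (expR y) -> P x y) ->
  forall x y, hs x -> hs y -> a <= x -> x < y -> y <= b -> F x = F y -> P x y.
Proof.
move=> Pm Pl Pr x y Dx Dy ax xy yb Fxy.
have [h1 h2 h3 h4] := gap_bounds G.
(* n bounds the number of expansions that fit into the gap, of length < 1. *)
have [n] : exists n, (y - x)^-1 <= c ^+ n.
  have lim := @cvg_geometric_shift R 0 1 k (gap_period G).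
  have yx0 : 0 < y - x by lra.
  have [n /=] := filter_ex (cvgr_lt _ lim _ yx0).
  rewrite add0r div1r => wn; exists n; rewrite -[leRHS]invrK lef_pV2 ?posrE ?invr_gt0 ?exprn_gt0//.
  exact: ltW.
rewrite -[_ <= _](ler_pM2r (_ : 0 < y - x)); last by lra.
rewrite mulVf ?gt_eqF//; last by lra.
elim: n x y Dx Dy ax xy yb Fxy => [|n IH] x y Dx Dy ax xy yb Fxy cn.
  by move: cn; rewrite expr0; lra.
have c1 := expansion_gt1 G; have gE := gap_expand G.
have Fb2 := plift_right_antipode; have Fa2 := plift_left_antipode.
have [xl|xr] : in_branches a b x by apply: (in_horseshoe_branches Dx); lra.
  have [yl|yr] : in_branches a b y by apply: (in_horseshoe_branches Dy); lra.
  - apply: Pl => //; first by lra.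
    have [|||e1|[e1 e2]] := plift_expand_eq (expand_left G) Dx Dy Fxy.
    + by have := expL_itv xl; lra.
    + by rewrite lerD2l ler_pM2l; lra.
    + by have := expL_itv yl; lra.
    + apply: IH => //.
      * exact: in_horseshoe_expL.
      * exact: in_horseshoe_expL.
      * by have := expL_itv xl; lra.
      * by rewrite ltrD2l ltr_pM2l; lra.
      * by have := expL_itv yl; lra.
      * by move: cn; rewrite exprSr -mulrA; congr (_ <= _ * _); ring.
    + by exfalso; move: Fxy; rewrite (expL_eq_left e1) (expL_eq_right e2); lra.
  - have Fx : F x <= F (b - 2^-1) by apply: (plift_homo PF); lra.
    have Fy : F (a + 2^-1) <= F y by apply: (plift_homo PF); lra.
    rewrite (plift_fibre_left_antipode xl Dx); last by lra.
    by rewrite (plift_fibre_right_antipode yr Dy)//; lra.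
have [yl|yr] : in_branches a b y by apply: (in_horseshoe_branches Dy); lra.
  by exfalso; lra.
apply: Pr => //; try by lra.
have [|||e1|[e1 e2]] := plift_expand_eq (expand_right G) Dx Dy Fxy.
+ by have := expR_itv xr; lra.
+ by rewrite lerD2l lerN2 ler_pM2l; lra.
+ by have := expR_itv yr; lra.
+ apply: IH => //.
  * exact: in_horseshoe_expR.
  * exact: in_horseshoe_expR.
  * by have := expR_itv xr; lra.
  * by rewrite ltrD2l ltrN2 ltr_pM2l; lra.
  * by have := expR_itv yr; lra.
  * by move: cn; rewrite exprSr -mulrA; congr (_ <= _ * _); ring.
+ by exfalso; have Fb := plift_right_end; move: Fxy; rewrite (expR_eq_left e1) (expR_eq_right e2); lra.
Qed.

(** By [fibre_ind], since no point of the horseshoe lies between b - 1/2 and a + 1/2.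
In particular a fibre does not straddle an end of the diameter, if this end lies in
the horseshoe. *)
Lemma fibre_no_between x y z : hs x -> hs y -> hs z -> a <= x -> x < z -> z < y -> y <= b ->
  F x = F y -> False.
Proof.
move=> Dx Dy Dz ax xz zy yb Fxy.
have [h1 h2 h3 h4] := gap_bounds G.
have c1 := expansion_gt1 G.
apply: (@fibre_ind (fun x y => forall z, hs z -> x < z -> z < y -> False)
   _ _ _ x y Dx Dy ax (lt_trans xz zy) yb Fxy z Dz xz zy).
- move=> t /in_horseshoe_gaps/(_ (modZ_refl t))[] h _ t1 t2; apply: h; lra.
- move=> s t _ _ _ _ _ _ IH r Dr sr rt; apply: (IH _ (in_horseshoe_expL Dr)).
  + by rewrite ltrD2l ltr_pM2l; lra.
  + by rewrite ltrD2l ltr_pM2l; lra.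
- move=> s t _ _ _ _ _ _ IH r Dr sr rt; apply: (IH _ (in_horseshoe_expR Dr)).
  + by rewrite ltrD2l ltrN2 ltr_pM2l; lra.
  + by rewrite ltrD2l ltrN2 ltr_pM2l; lra.
Qed.

End PruningLift.

(** * The image of a critical relation under a pruning *)
Section PrunedRelation.
Context {R : realType}.
Implicit Types (s t u v x y z : R) (n : nat).
Context (theta a b : R) (k : nat) (G : rotational_gap theta a b k).
Local Notation c := (2 ^+ k : R).
Local Notation hs := (in_horseshoe a b k).
Context (F : R -> R) (PF : pruning_lift a b k F).
Context (e : R -> R -> Prop) (E : critical_relation theta e).
Context (Dtheta : hs theta) (ne_b : theta <> b) (ne_a : theta <> a + 2^-1).

Definition pruned_relation s t : Prop :=
  exists x y, [/\ hs x, hs y, e x y, F x = s & F y = t].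

Lemma in_horseshoe_antitheta : hs (theta - 2^-1).
Proof.
have [h1 h2 h3 h4] := gap_bounds G.
apply: (in_horseshoe_antipode G (s := theta)) => //; first by left; lra.
by left; rewrite subrK.
Qed.

(** The two values agree after doubling, so they differ by 0, 1/2 or 1. A difference
0 means that both are F a + 1/2, and a difference 1 that they are F a and F b; then
the diameter would end in A. *)
Lemma plift_antitheta : F (theta - 2^-1) = F theta - 2^-1.
Proof.
have [h1 h2 h3 h4] := gap_bounds G.
have F1 : F a <= F (theta - 2^-1) by apply: (plift_homo PF); lra.
have F2 : F (theta - 2^-1) <= F (b - 2^-1) by apply: (plift_homo PF); lra.
have F3 : F (a + 2^-1) <= F theta by apply: (plift_homo PF); lra.
have F4 : F theta <= F b by apply: (plift_homo PF); lra.
rewrite (plift_left_antipode PF) in F3; rewrite (plift_right_antipode G PF) in F2.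
rewrite (plift_right_end G PF) in F4.
have dbl : modZ (2 * F theta) (2 * F (theta - 2^-1)).
  apply: modZ_trans (modZ_sym (plift_expand PF Dtheta)) _.
  apply: modZ_trans (plift_expand PF in_horseshoe_antitheta).
  apply: (plift_modZ PF).
  rewrite -{1}(subrK 2^-1 theta); apply: doubling_shift_half.
  exact: gap_period G.
have [k2|k2] := leP (2 * F theta) (2 * F (theta - 2^-1) + 1).
  have [h|h] : 2 * F theta = 2 * F (theta - 2^-1) \/
     2 * F theta = 2 * F (theta - 2^-1) + 1.
  - by apply: modZ_diff1 => //; lra.
  - case: ne_a; apply: (plift_fibre_right_antipode G PF) => //; lra.
  - lra.
have dbl' : modZ (2 * F theta) (2 * F (theta - 2^-1) + 1).
  by apply: modZ_trans dbl (modZ_sym _); exact: (modZDint 1).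
have [h|h] : 2 * F theta = 2 * F (theta - 2^-1) + 1 \/
     2 * F theta = 2 * F (theta - 2^-1) + 1 + 1.
- by apply: modZ_diff1 => //; lra.
- lra.
- case: ne_b; apply: (plift_fibre_right G PF) => //.
  by rewrite (plift_right_end G PF); lra.
Qed.

(** Induction along [fibre_ind]. Two points of a fibre in the same branch are on the
same side of the diameter by [fibre_no_between], so their relation is pulled back
from their images. *)
Lemma fibre_related_lt x y : hs x -> hs y -> a <= x -> x < y -> y <= b ->
  F x = F y -> e x y.
Proof.
have [h1 h2 h3 h4] := gap_bounds G.
apply: (fibre_ind G PF).
- exact: (antipodal_gap_ends_related G E).
- move=> {}x {}y Dx Dy ax xy yb Fxy exy.
  have [u hu [ux uy]] : exists2 u, u = theta \/ u = theta - 2^-1 &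
      half_arc u x /\ half_arc u y.
    have [yt|yt] := leP y (theta - 2^-1).
      exists theta; first by left.
      by split; [exists (x + 1)|exists (y + 1)]; try exact: (modZDint 1); lra.
    have [xt|xt] := leP (theta - 2^-1) x.
      by exists (theta - 2^-1); [by right|split; apply: half_arc_mem; lra].
    exfalso; apply: (fibre_no_between G PF Dx Dy in_horseshoe_antitheta) => //; lra.
  apply: (pull_back_period G E hu) => //; [by left; lra|by left; lra|].
  apply: (crel_trans E (crel_modZ E (expand_left G _))).
  exact: (crel_trans E exy (crel_modZ E (modZ_sym (expand_left G _)))).
- move=> {}x {}y Dx Dy ax xy yb Fxy exy.
  have [u hu [ux uy]] : exists2 u, u = theta \/ u = theta - 2^-1 &
      half_arc u x /\ half_arc u y.
    have [yt|yt] := leP y theta.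
      by exists (theta - 2^-1); [by right|split; apply: half_arc_mem; lra].
    have [xt|xt] := leP theta x.
      by exists theta; [by left|split; apply: half_arc_mem; lra].
    exfalso; apply: (fibre_no_between G PF Dx Dy Dtheta) => //; lra.
  apply: (pull_back_period G E hu) => //; [by right; lra|by right; lra|].
  apply: (crel_trans E (crel_modZ E (expand_right G _))).
  exact: (crel_trans E exy (crel_modZ E (modZ_sym (expand_right G _)))).
Qed.

Lemma fibre_related_itv x y : hs x -> hs y -> a <= x <= b -> a <= y <= b ->
  F x <= F y -> modZ (F y) (F x) -> e x y.
Proof.
move=> Dx Dy xab yab Fxy FF.
have Fb := plift_right_end G PF.
have Fx := plift_itv G PF xab; have Fy := plift_itv G PF yab.
case: (modZ_diff1 FF) => [|h|h]; first by lra.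
- have [xy|yx|<-] := ltgtP x y.
  + by apply: fibre_related_lt => //; lra.
  + by apply: (crel_sym E); apply: fibre_related_lt => //; lra.
  + exact/(crel_modZ E)/modZ_refl.
- have -> : x = a by apply: (plift_fibre_left G PF); lra.
  have -> : y = b by apply: (plift_fibre_right G PF); lra.
  exact: (gap_ends_related G E).
Qed.

Lemma fibre_related x y : hs x -> hs y -> modZ (F x) (F y) -> e x y.
Proof.
move=> Dx Dy Fxy.
have [x' xx x'ab] := in_horseshoe_lift Dx.
have [y' yy y'ab] := in_horseshoe_lift Dy.
have Dx' := in_horseshoe_modZ (modZ_sym xx) Dx.
have Dy' := in_horseshoe_modZ (modZ_sym yy) Dy.
have Fxy' : modZ (F x') (F y').
  apply: modZ_trans (plift_modZ PF xx) _.
  exact: modZ_trans Fxy (plift_modZ PF (modZ_sym yy)).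
apply: (crel_trans E (crel_modZ E (modZ_sym xx))).
apply: (crel_trans E _ (crel_modZ E yy)).
have [le|/ltW le] := leP (F x') (F y').
  by apply: fibre_related_itv => //; exact: modZ_sym.
by apply: (crel_sym E); exact: fibre_related_itv.
Qed.

Lemma pruned_relationI x y s t : hs x -> hs y -> e x y ->
  modZ (F x) s -> modZ (F y) t -> pruned_relation s t.
Proof.
move=> Dx Dy exy /modZ_sym/modZP[m sE] /modZ_sym/modZP[n tE].
exists (x + m%:~R), (y + n%:~R); split.
- exact: in_horseshoe_modZ (modZ_sym (modZDint _ _)) Dx.
- exact: in_horseshoe_modZ (modZ_sym (modZDint _ _)) Dy.
- apply: (crel_trans E (crel_modZ E (modZDint _ _))).
  exact: (crel_trans E exy (crel_modZ E (modZ_sym (modZDint _ _)))).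
- by rewrite (plift_int PF).
- by rewrite (plift_int PF).
Qed.

Lemma plift_bounded x : `|F x - x - (F a - a)| <= 1.
Proof.
have [t /modZP[n ->]] := modZ_fundamental a x => xa.
have F1 : F a <= F (x + n%:~R) by apply: (plift_homo PF); lra.
have F2 : F (x + n%:~R) <= F (a + 1) by apply: (plift_homo PF); lra.
rewrite (plift_int PF) in F1 F2; rewrite (plift_degree PF) in F2.
rewrite ler_norml; lra.
Qed.

(** F x - x is bounded, so applying F to both coordinates is a proper map of the plane,
and it maps closed sets to closed sets. *)
Lemma pruned_relation_closed : closed [set p : R * R | pruned_relation p.1 p.2].
Proof.
pose K := [set p : R * R | [/\ hs p.1, hs p.2 & e p.1 p.2]].
have closedK : closed K.
  rewrite (_ : K = [set p | hs p.1] `&` [set p | hs p.2] `&` [set p | e p.1 p.2]).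
    apply: closedI; last exact: (crel_closed E).
    apply: closedI.
      apply: (@preimage_closed _ _ fst [set t | hs t]).
        by move=> p _; exact: cvg_fst.
      exact: closed_in_horseshoe.
    apply: (@preimage_closed _ _ snd [set t | hs t]).
      by move=> p _; exact: cvg_snd.
    exact: closed_in_horseshoe.
  by apply/seteqP; split=> [p [? ? ?]|p [[? ?] ?]].
pose FF (p : R * R) := (F p.1, F p.2).
have contFF : continuous FF.
  move=> p.
  have c1 : F \o fst @ p --> F p.1.
    by apply: continuous_comp; [exact: cvg_fst|exact: (plift_cont PF)].
  have c2 : F \o snd @ p --> F p.2.
    by apply: continuous_comp; [exact: cvg_snd|exact: (plift_cont PF)].
  exact: (cvg_pair c1 c2).
have relE : [set p : R * R | pruned_relation p.1 p.2] = FF @` K.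
  apply/seteqP; split=> [[s t] /= [x [y [Dx Dy exy <- <-]]]|_ [[x y] [Dx Dy exy] <-]].
    by exists (x, y).
  by exists x, y.
rewrite relE => -[s t] cl.
(* If F x is within 1 of s, then x is within 2 of s - d. *)
pose d := F a - a.
pose B := `[s - d - 2, s - d + 2] `*` `[t - d - 2, t - d + 2].
have compB : compact (K `&` B).
  apply: (@subclosed_compact _ _ B).
  - apply: closedI => //; apply: compact_closed; first exact: norm_hausdorff.
    by apply: compact_setX; exact: segment_compact.
  - by apply: compact_setX; exact: segment_compact.
  - by move=> ? [].
have closedB : closed (FF @` (K `&` B)).
  apply: compact_closed; first exact: norm_hausdorff.
  by apply: continuous_compact => //; exact: continuous_subspaceT.
suff : (FF @` (K `&` B)) (s, t) by move=> [p [Kp _] <-]; exists p.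
apply: closedB => U nU.
have nU1 : nbhs (s, t) (U `&` ball (s, t) 1).
  by apply: filterI => //; exact: nbhsx_ballx.
have [_ [[[x y] Kp <-] [Up [b1 b2]]]] := cl _ nU1.
exists (FF (x, y)); split=> //; exists (x, y) => //; split => //.
have := plift_bounded x; have := plift_bounded y.
move: b1 b2; rewrite /ball /= !ler_norml !ltr_norml /B /= !in_itv /= /d.
by move=> ? ? ? ?; split; lra.
Qed.

(** F is monotone, so a point x of the horseshoe outside [u, v] whose value lies in
[F u, F v] has the value of one of the ends, and this end may replace it. *)
Lemma arc_onto u v s : hs u -> hs v -> v = u + 2^-1 -> F v = F u + 2^-1 ->
  half_arc (F u) s -> exists x, [/\ in_branches a b x, hs x, half_arc u x & modZ (F x) s].
Proof.
move=> Du Dv vu Fv [r rs /andP[ur rv]].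
suff [x [Dx ux xs]] : exists x, [/\ hs x, half_arc u x & modZ (F x) s].
  have [x' xx x'ab] := in_horseshoe_lift Dx.
  have Dx' := in_horseshoe_modZ (modZ_sym xx) Dx.
  exists x'; split=> //; first exact: (in_horseshoe_branches Dx' x'ab).
    exact: half_arc_modZ (modZ_sym xx) ux.
  exact: modZ_trans (plift_modZ PF xx) xs.
have [x Dx Fx] := plift_onto PF r.
have [xu|xu] := leP u x; last first.
  have := plift_homo PF (ltW xu); rewrite Fx => ru.
  exists u; split=> //; first by apply: half_arc_mem; lra.
  by have -> : F u = r by apply/eqP; rewrite eq_le ru ur.
have [xv|xv] := leP x v; first by exists x; rewrite Fx; split=> //; apply: half_arc_mem; lra.
have := plift_homo PF (ltW xv); rewrite Fx => ru.
exists v; split=> //; first by apply: half_arc_mem; lra.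
by have -> : F v = r by apply/eqP; rewrite eq_le ru Fv rv.
Qed.

(** Transitivity and the pull-back rule both rest on [fibre_related]. For the latter,
representatives are taken on the right side of the diameter by [arc_onto]; then
F (c x) = 2 F x turns the hypothesis on the images into c x ~ c y. *)
Lemma pruned_critical_relation : critical_relation (F theta) pruned_relation.
Proof.
have [Em Es Et Ec E2 Ed Ep] := E.
have Dt' := in_horseshoe_antitheta; have Ft' := plift_antitheta.
split.
- move=> s t st; have [x Dx Fx] := plift_onto PF s.
  by apply: (pruned_relationI Dx Dx); rewrite ?Fx //; [exact/Em/modZ_refl|exact: modZ_refl].
- by move=> s t [x [y [Dx Dy exy Fx Fy]]]; exists y, x; split=> //; exact: Es.
- move=> _ t _ [x [y [Dx Dy exy <- <-]]] [y' [z [Dy' Dz eyz Fy' <-]]].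
  exists x, z; split=> //; apply: (Et _ _ _ exy); apply: Et eyz.
  by apply: fibre_related => //; rewrite Fy'; exact: modZ_refl.
- exact: pruned_relation_closed.
- move=> _ _ [x [y [Dx Dy exy <- <-]]].
  apply: (@pruned_relationI (c * x) (c * y)); try exact: in_horseshoe_expand.
  + elim: k => [|i IH]; first by rewrite !mul1r.
    by rewrite !exprS -!mulrA; exact: E2.
  + exact: (plift_expand PF Dx).
  + exact: (plift_expand PF Dy).
- by exists theta, (theta - 2^-1).
- move=> u s t hu us ut [p [q [Dp Dq epq Fp Fq]]].
  have [w [hw Dw Dw' [Fw FE]]] : exists w, [/\ w = theta \/ w = theta - 2^-1, hs w,
     hs (w + 2^-1) & F (w + 2^-1) = F w + 2^-1 /\ u = F w].
    case: hu => ->.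
      have tt : modZ (theta - 2^-1) (theta + 2^-1).
        by rewrite /modZ (_ : _ - _ = - 1) ?rpredN ?int_num1//; lra.
      exists theta; split=> //; [by left|exact: in_horseshoe_modZ Dt'|split=> //].
      rewrite (_ : theta + 2^-1 = theta - 2^-1 + 1); last by lra.
      by rewrite (plift_degree PF) Ft'; lra.
    exists (theta - 2^-1); rewrite subrK Ft'; split=> //; first by right.
    by split=> //; lra.
  rewrite FE in us ut.
  have [x [bx Dx wx Fx]] := arc_onto Dw Dw' erefl Fw us.
  have [y [by_ Dy wy Fy]] := arc_onto Dw Dw' erefl Fw ut.
  apply: (pruned_relationI Dx Dy) => //.
  apply: (pull_back_period G E hw) => //.
  have key z r r' : hs z -> hs r -> F r = 2 * r' -> modZ (F z) r' -> e (c * z) r.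
    move=> Dz Dr Fr Fz; apply: fibre_related => //; first exact: in_horseshoe_expand.
    apply: modZ_trans (plift_expand PF Dz) _; rewrite Fr; exact: modZ2.
  apply: (Et _ p); first exact: (key _ _ _ Dx Dp Fp Fx).
  by apply: (Et _ q) => //; apply: Es; exact: (key _ _ _ Dy Dq Fq Fy).
Qed.

(** F b and F (b - 1/2) are related in the image, and the fibres through b and
b - 1/2 are each in one class. *)
Lemma pruned_total : (forall s t, pruned_relation s t) -> forall s t, e s t.
Proof.
have [h1 h2 h3 h4] := gap_bounds G.
move=> tot; apply: (gap_total G E).
have [x [y [Dx Dy exy Fx Fy]]] := tot (F b) (F (b - 2^-1)).
have Db2 : hs (b - 2^-1).
  by apply: (in_horseshoe_antipode G (s := b)); [left; lra|exact: (in_horseshoe_right_end G)|left; rewrite subrK].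
apply: (crel_trans E (t := x)).
  by apply: fibre_related => //; [exact: (in_horseshoe_right_end G)|rewrite Fx; exact: modZ_refl].
apply: (crel_trans E exy).
by apply: fibre_related => //; rewrite Fy; exact: modZ_refl.
Qed.

End PrunedRelation.

(** * The circle in real coordinates *)
Section Circle.
Context {R : realType}.
Local Notation T := (circle R).
Implicit Types (x y : T) (r s t : R).

Lemma toT_eq s t : toT s = toT t :> T <-> modZ s t.
Proof.
rewrite /toT /modZ; split.
  by move=> /eqmodP; rewrite /= Quotient.equivE.
by move=> st; apply/eqmodP; rewrite /= Quotient.equivE.
Qed.

Lemma toT_surj x : exists t, toT t = x.
Proof. by exists (repr x); rewrite /toT reprK. Qed.

Lemma toTD s t : toT (s + t) = toT s + toT t :> T.
Proof. by rewrite /toT; exact: Quotient.pi_add. Qed.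

Lemma toT0 : toT 0 = 0 :> T.
Proof. by apply: (addrI (toT 0)); rewrite -toTD !addr0. Qed.

Lemma toTB s t : toT (s - t) = toT s - toT t :> T.
Proof. by apply: (addIr (toT t)); rewrite -toTD !subrK. Qed.

Lemma sigma_toT t : sigma (toT t : T) = toT (2 * t).
Proof. by rewrite /sigma mulr2n -toTD mulr_natl mulr2n. Qed.

Lemma iter_sigma_toT i t : iter i sigma (toT t : T) = toT (2 ^+ i * t).
Proof.
elim: i => [|i IH]; first by rewrite mul1r.
by rewrite iterS IH sigma_toT exprS mulrA.
Qed.

Lemma antipode_toT t : antipode (toT t : T) = toT (t + 2^-1).
Proof. by rewrite /antipode /half_pt toTD. Qed.

Lemma fracpart_itv x : 0 <= fracpart x < 1.
Proof. by rewrite /fracpart; have := floor_itv (repr x); rewrite intrD; lra. Qed.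

Lemma fracpart_modZ t : modZ (fracpart (toT t : T)) t.
Proof.
rewrite /fracpart; apply: (@modZ_trans _ _ (repr (toT t : T))).
  by rewrite -mulrNz; exact: modZDint.
by apply/toT_eq; rewrite [LHS]reprK.
Qed.

Lemma arclen_toT s t : s <= t < s + 1 -> arclen (toT s : T) (toT t) = t - s.
Proof.
move=> st; rewrite /arclen -toTB; apply: modZ_eq; first exact: fracpart_modZ.
have := fracpart_itv (toT (t - s)); lra.
Qed.

Lemma arc_cc_toT s t r : s <= t < s + 1 ->
  arc_cc (toT s : T) (toT t) (toT r) <-> exists2 r', modZ r' r & s <= r' <= t.
Proof.
move=> st; rewrite /arc_cc /= (arclen_toT st).
have [u ur su] := modZ_fundamental s r.
have -> : toT r = toT u :> T by apply/toT_eq; exact: modZ_sym.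
rewrite (arclen_toT su); split=> [h|[v vr sv]]; first by exists u; [|lra].
have -> : u = v; last by lra.
apply: modZ_eq; [exact: modZ_trans ur (modZ_sym vr)|lra].
Qed.

Lemma arc_oo_toT s t r : s <= t < s + 1 ->
  arc_oo (toT s : T) (toT t) (toT r) <-> exists2 r', modZ r' r & s < r' < t.
Proof.
move=> st; rewrite /arc_oo /= (arclen_toT st).
have [u ur su] := modZ_fundamental s r.
have -> : toT r = toT u :> T by apply/toT_eq; exact: modZ_sym.
rewrite (arclen_toT su); split=> [h|[v vr sv]]; first by exists u; [|lra].
have -> : u = v; last by lra.
apply: modZ_eq; [exact: modZ_trans ur (modZ_sym vr)|lra].
Qed.

Lemma toT_continuous : continuous (toT : R -> T).
Proof. exact: pi_continuous. Qed.

Lemma arc_cc_half_arc s r :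
  arc_cc (toT s : T) (antipode (toT s)) (toT r) <-> half_arc s r.
Proof. by rewrite antipode_toT; apply: arc_cc_toT; lra. Qed.

End Circle.

(** * Gaps of a rotational orbit *)
Section RotationalOrbit.
Context {R : realType}.
Implicit Types (p q r s t u v a b : R) (e : R -> R -> Prop) (i j n : nat).

(** The orbit of t0 has exact period k, and H, which lifts a homeomorphism of the
circle, conjugates the doubling map on it to the rotation by rho. *)
Record rotational_lift k t0 (H : R -> R) (rho : R) : Prop := RotationalLift {
  rlift_period : (0 < k)%N;
  rlift_fix : modZ (2 ^+ k * t0) t0;
  rlift_min : forall j, (0 < j < k)%N -> ~ modZ (2 ^+ j * t0) t0;
  rlift_mono : {mono H : s t / s < t};
  rlift_int : forall t (n : int), H (t + n%:~R) = H t + n%:~R;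
  rlift_rot : forall i, modZ (H (2 ^+ i.+1 * t0)) (H (2 ^+ i * t0) + rho) }.

Context (k : nat) (t0 : R) (H : R -> R) (rho : R) (O : rotational_lift k t0 H rho).

Definition on_orbit t := exists i, modZ t (2 ^+ i * t0).

Lemma on_orbit_modZ s t : modZ s t -> on_orbit s -> on_orbit t.
Proof. by move=> st [i si]; exists i; exact: modZ_trans (modZ_sym st) si. Qed.

Lemma on_orbit_double t : on_orbit t -> on_orbit (2 * t).
Proof. by move=> [i ti]; exists i.+1; rewrite exprS -mulrA; exact: modZ2. Qed.

Lemma orbit_fix_iter t j : modZ (2 ^+ k * t) t -> modZ (2 ^+ (k * j) * t) t.
Proof.
move=> kt; elim: j => [|j IH]; first by rewrite muln0 expr0 mul1r; exact: modZ_refl.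
by rewrite mulnS addnC exprD -mulrA; apply: modZ_trans IH; exact: modZX.
Qed.

Lemma on_orbit_fix t : on_orbit t -> modZ (2 ^+ k * t) t.
Proof.
move=> [i ti]; apply: modZ_trans (modZX k ti) _; apply: modZ_trans (modZ_sym ti).
by rewrite mulrCA; exact/modZX/(rlift_fix O).
Qed.

Lemma on_orbit_trans s t : on_orbit s -> on_orbit t ->
  exists2 i, (0 < i <= k)%N & modZ t (2 ^+ i * s).
Proof.
move=> Os; have fs := on_orbit_fix Os; have k0 := rlift_period O.
case: Os => i si [j tj].
have [m tm] : exists m, modZ t (2 ^+ m * s).
  exists (j + (k.-1 * i))%N; apply: modZ_trans tj _.
  rewrite exprD -mulrA; apply: modZX; apply: modZ_sym.
  apply: modZ_trans (modZX _ si) _.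
  rewrite mulrA -exprD -mulSnr prednK//.
  exact/orbit_fix_iter/(rlift_fix O).
have mE : modZ t (2 ^+ (m %% k) * s).
  apply: modZ_trans tm _; rewrite {1}(divn_eq m k) addnC exprD -mulrA.
  by apply: modZX; rewrite mulnC; exact: orbit_fix_iter.
have [m0|m0] := posnP (m %% k).
  exists k; first by rewrite k0 leqnn.
  by rewrite m0 expr0 mul1r in mE; exact: modZ_trans mE (modZ_sym fs).
by exists (m %% k)%N => //; rewrite m0 ltnW// ltn_mod.
Qed.

Lemma on_orbit_pre t : on_orbit t -> exists2 s, on_orbit s & modZ (2 * s) t.
Proof.
move=> Ot; have [[//|i] _ ti] := on_orbit_trans Ot Ot.
exists (2 ^+ i * t); last by rewrite mulrA -exprS; exact: modZ_sym.
elim: i {ti} => [|i IH]; first by rewrite mul1r.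
by rewrite exprS -mulrA; exact: on_orbit_double.
Qed.

Lemma on_orbit_min t j : on_orbit t -> (0 < j < k)%N -> ~ modZ (2 ^+ j * t) t.
Proof.
move=> Ot jk tj.
have Ot0 : on_orbit t0 by exists 0%N; rewrite mul1r; exact: modZ_refl.
have [i _ ti] := on_orbit_trans Ot Ot0.
apply: (rlift_min O jk); apply: modZ_trans (modZX _ ti) _.
by rewrite mulrCA; apply: modZ_trans (modZX _ tj) (modZ_sym ti).
Qed.

Lemma on_orbit_rot t : on_orbit t -> modZ (H (2 * t)) (H t + rho).
Proof.
move=> [i /modZP[m ->]]; rewrite (rlift_int O) mulrDr.
rewrite (_ : 2 * m%:~R = (2 * m)%:~R); last by rewrite intrM.
rewrite (rlift_int O) mulrA -exprS addrAC.
apply: modZD; first exact: rlift_rot O i.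
by rewrite /modZ -intrB intr_int.
Qed.

Lemma rlift_lt s t : (H s < H t) = (s < t).
Proof. exact: (rlift_mono O). Qed.

Lemma rlift_le s t : (H s <= H t) = (s <= t).
Proof. by rewrite !leNgt rlift_lt. Qed.

Definition consecutive s t :=
  [/\ on_orbit s, on_orbit t, s < t, t <= s + 1 &
      forall u, on_orbit u -> s < u -> u < t -> False].

Lemma consecutive_shift s t (n : int) :
  consecutive s t -> consecutive (s + n%:~R) (t + n%:~R).
Proof.
move=> [Os Ot st ts gap]; split; try lra.
- exact: on_orbit_modZ (modZ_sym (modZDint _ _)) Os.
- exact: on_orbit_modZ (modZ_sym (modZDint _ _)) Ot.
- move=> u Ou su ut; apply: (gap (u - n%:~R)); try lra.
  by rewrite -mulrNz; exact: on_orbit_modZ (modZ_sym (modZDint _ _)) Ou.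
Qed.

Lemma consecutive_unique s t u : consecutive s t -> consecutive s u -> t = u.
Proof.
move=> [_ Ot st _ gt] [_ Ou su _ gu]; have [tu|ut|//] := ltgtP t u.
- by case: (gu _ Ot st tu).
- by case: (gt _ Ou su ut).
Qed.

(** In the coordinate H the doubling map is a translation on the orbit, and the orbit
is mapped onto itself: a point of the orbit between the images would come from one
between s and t. *)
Lemma consecutive_double s t : consecutive s t ->
  exists2 u, modZ u (2 * t) & consecutive (2 * s) u.
Proof.
move=> [Os Ot st ts gap].
have [m Hs] := modZP (on_orbit_rot Os); have [n Ht] := modZP (on_orbit_rot Ot).
(* The lift of the image of t for which H u - H (2 s) = H t - H s. *)
pose u := 2 * t + (m - n)%:~R.
have Hu : H u = H t + rho + m%:~R by rewrite /u (rlift_int O) Ht intrB; ring.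
have ut : modZ u (2 * t) by exact: modZDint.
have H1 x : H (x + 1) = H x + 1 by exact: (rlift_int O x 1).
exists u => //; split.
- exact: on_orbit_double.
- exact: on_orbit_modZ (modZ_sym ut) (on_orbit_double Ot).
- by rewrite -rlift_lt Hu Hs; move: st; rewrite -rlift_lt; lra.
- by rewrite -rlift_le H1 Hu Hs; move: ts; rewrite -rlift_le H1; lra.
move=> v Ov; rewrite -rlift_lt -[v < u]rlift_lt Hu Hs => sv vt.
have [w Ow /modZ_sym/modZP[q vE]] := on_orbit_pre Ov.
have [p Hw] := modZP (on_orbit_rot Ow).
have Hv : H v = H w + rho + p%:~R + q%:~R by rewrite vE (rlift_int O) Hw.
apply: (gap (w + (p + q - m)%:~R)).
- exact: on_orbit_modZ (modZ_sym (modZDint _ _)) Ow.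
- by rewrite -rlift_lt (rlift_int O) intrB intrD; lra.
- by rewrite -rlift_lt (rlift_int O) intrB intrD; lra.
Qed.

Lemma consecutive_iter s t i : consecutive s t ->
  exists2 u, modZ u (2 ^+ i * t) & consecutive (2 ^+ i * s) u.
Proof.
move=> st; elim: i => [|i [u ut su]].
  by rewrite !mul1r; exists t => //; exact: modZ_refl.
have [v vu sv] := consecutive_double su.
exists v; last by rewrite exprS -mulrA.
by rewrite exprS -mulrA; apply: modZ_trans vu _; exact: modZ2.
Qed.

Lemma exists_predecessor b : on_orbit b -> exists a, consecutive a b.
Proof.
move=> Ob.
have rep i : exists u, modZ u (2 ^+ i * t0) /\ b - 1 <= u < b.
  have [u] := modZ_fundamental (b - 1) (2 ^+ i * t0).
  by rewrite subrK => ? ?; exists u.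
have [u uP] := choice rep.
have Ot0 : on_orbit t0 by exists 0%N; rewrite mul1r; exact: modZ_refl.
case: (@arg_maxP _ R 'I_k.+1 ord0 xpredT (fun i : 'I_k.+1 => u i) isT) => m _ mmax.
have [um /andP[bu ub]] := uP m.
have Oum : on_orbit (u m) by exists m.
exists (u m); split=> //; first by lra.
move=> v Ov uv vb; have [i /andP[_ ik] vi] := on_orbit_trans Ot0 Ov.
have [ui /andP[bui uib]] := uP i.
have vE : v = u i by apply: modZ_eq; [exact: modZ_trans vi (modZ_sym ui)|lra].
have ik' : (i < k.+1)%N by [].
by have := mmax (Ordinal ik') isT; rewrite /= -vE; lra.
Qed.

(** The gap that ends at a is mapped by some iterate to the gap that starts at a. *)
Lemma exists_successor a : on_orbit a -> exists b, consecutive a b.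
Proof.
move=> Oa; have [p pa] := exists_predecessor Oa.
have Op : on_orbit p by case: pa.
have [i _ /modZP[m ->]] := on_orbit_trans Op Oa.
have [u _ /(consecutive_shift m)pu] := consecutive_iter i pa.
by exists (u + m%:~R).
Qed.

Lemma consecutive_full a : consecutive a (a + 1) -> modZ (2 * a) a.
Proof.
move=> [Oa _ _ _ gap].
have [u u2 au] := modZ_fundamental a (2 * a).
have Ou := on_orbit_modZ (modZ_sym u2) (on_orbit_double Oa).
have [ltau|leua] := ltP a u; first by case: (gap u) => //; lra.
have ua : u = a by lra.
by rewrite -{2}ua; exact: modZ_sym.
Qed.

Section LongGap.
Context (a b : R) (ab : consecutive a b) (long : 2^-1 < b - a) (short : b - a < 1).

(** By exact periodicity the i-th image of the gap is another gap, so it lies in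
[b, a + 1]. *)
Lemma gap_avoids i t : (0 < i < k)%N -> consecutive (2 ^+ i * a) t ->
  exists2 s, modZ s (2 ^+ i * a) & b <= s <= a + 1 - (t - 2 ^+ i * a).
Proof.
move=> ik it; have [Oa Ob ltab _ gab] := ab.
have [s si /andP[as_ sa]] := modZ_fundamental a (2 ^+ i * a).
have Os : on_orbit s by case: it => Oi _ _ _ _; exact: on_orbit_modZ (modZ_sym si) Oi.
have sna : s != a.
  by apply/eqP => sa'; apply: (on_orbit_min Oa ik); rewrite -{2}sa'; exact: modZ_sym.
have ltas : a < s by rewrite lt_neqAle eq_sym sna.
exists s => //; apply/andP; split.
  by rewrite leNgt; apply/negP => sb; case: (gab s).
have [m sE] := modZP si; have [_ _ _ _ gap] := consecutive_shift m it.
rewrite lerBrDr leNgt; apply/negP => lt; apply: (gap (a + 1)); try lra.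
exact: on_orbit_modZ (modZ_sym (modZDint 1 _)) Oa.
Qed.

(** The gap has length between 1/2 and 1, so its image is the arc of length
2 (b - a) - 1; the following images have length < 1/2, because they are disjoint
from the long gap, and so they double. *)
Lemma gap_image i : (i < k)%N ->
  consecutive (2 ^+ i.+1 * a) (2 ^+ i.+1 * a + 2 ^+ i * (2 * (b - a) - 1)) /\
  modZ (2 ^+ i.+1 * b) (2 ^+ i.+1 * a + 2 ^+ i * (2 * (b - a) - 1)).
Proof.
elim: i => [|i IH] ik.
  have [u u2 au] := consecutive_double ab.
  have uE : u = 2 * a + (2 * (b - a) - 1).
    apply: modZ_eq; last by case: au => _ _ au1 au2 _; move: long short; lra.
    apply: modZ_trans u2 _; rewrite /modZ (_ : _ - _ = 1) ?int_num1//; lra.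
  by rewrite !expr1 expr0 mul1r -uE; split=> //; exact: modZ_sym.
have [con bi] := IH (ltnW ik).
have [s si] : exists2 s, modZ s (2 ^+ i.+1 * a) &
    b <= s <= a + 1 - (2 ^+ i.+1 * a + 2 ^+ i * (2 * (b - a) - 1) - 2 ^+ i.+1 * a).
  by apply: gap_avoids.
have [u u2 au] := consecutive_double con.
have d0 : 0 < 2 ^+ i * (2 * (b - a) - 1) by apply: mulr_gt0; [exact: exprn_gt0|move: long; lra].
have -> : 2 ^+ i.+2 * a = 2 * (2 ^+ i.+1 * a) by rewrite exprS mulrA.
have -> : 2 ^+ i.+2 * b = 2 * (2 ^+ i.+1 * b) by rewrite exprS mulrA.
have -> : 2 ^+ i.+1 * (2 * (b - a) - 1) = 2 * (2 ^+ i * (2 * (b - a) - 1)).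
  by rewrite exprS mulrA.
move: (2 ^+ i * (2 * (b - a) - 1)) (2 ^+ i.+1 * a) d0 con bi au u2 si => d A d0 con bi au u2 si As.
have uE : u = 2 * A + 2 * d.
  rewrite -mulrDr; apply: (modZ_eq u2); case: au => _ _ au1 au2 _.
  by move: long; lra.
rewrite -uE; split=> //; apply: modZ_trans (modZ2 bi) _.
by rewrite uE mulrDr; exact: modZ_refl.
Qed.

(** The k-th image of the gap is the gap itself. *)
Lemma gap_length : 2 ^+ k * (b - a - 2^-1) = b - a.
Proof.
have k0 := rlift_period O; have [Oa _ _ _ _] := ab.
have [] := @gap_image k.-1 _; first by rewrite prednK.
rewrite prednK// => con _.
have [m aE] := modZP (modZ_sym (on_orbit_fix Oa)).
have := consecutive_shift m con; rewrite addrAC -aE => con'.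
have := consecutive_unique ab con'.
by rewrite -{2}(prednK k0) exprSr; move: (2 ^+ k.-1) => z; lra.
Qed.

(** The gap after s is an image of the gap (a, b), and no image is shorter than the
first one; the images of a and b are related. *)
Lemma gap_step s : on_orbit s -> exists d, [/\ 2 * (b - a) - 1 <= d,
  consecutive s (s + d) & forall e theta, critical_relation theta e -> e a b -> e s (s + d)].
Proof.
have [Oa Ob _ _ _] := ab => Os.
have [[//|i] /andP[_ ik] /modZP[m sE]] := on_orbit_trans Oa Os.
have [con bi] := gap_image ik.
exists (2 ^+ i * (2 * (b - a) - 1)); split.
- have l0 : 0 <= 2 * (b - a) - 1 by move: long; lra.
  by rewrite -[leLHS]mul1r ler_wpM2r// exprn_ege1// ler1n.
- by rewrite sE addrAC; exact: consecutive_shift.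
move=> e theta E eab.
have eab' : e (2 ^+ i.+1 * a) (2 ^+ i.+1 * b).
  elim: (i.+1) => [|j IH]; first by rewrite !mul1r.
  by rewrite !exprS -!mulrA; exact: (crel_double E).
rewrite sE addrAC; apply: (crel_trans E (crel_modZ E (modZDint _ _))).
apply: (crel_trans E eab'); apply: (crel_trans E (crel_modZ E bi)).
by apply: (crel_modZ E); apply: modZ_sym; exact: modZDint.
Qed.

(** Going from each point to the next one, by steps bounded below, reaches every point
of the orbit from b. *)
Lemma orbit_chain e theta : critical_relation theta e -> e a b -> e (2 * b) b.
Proof.
move=> E eab; have [Oa Ob _ _ _] := ab.
have d0 : 0 < 2 * (b - a) - 1 by move: long; lra.
have [q q2 /andP[bq _]] := modZ_fundamental b (2 * b).
have Oq : on_orbit q := on_orbit_modZ (modZ_sym q2) (on_orbit_double Ob).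
apply: (crel_trans E (crel_modZ E (modZ_sym q2))); apply: (crel_sym E).
have [n qn] : exists n : nat, q - b < n%:R * (2 * (b - a) - 1).
  exists (Num.trunc ((q - b) / (2 * (b - a) - 1))).+1.
  by rewrite -ltr_pdivrMr// truncnS_gt.
suff key s : on_orbit s -> s <= q -> q - s < n%:R * (2 * (b - a) - 1) -> e s q.
  exact: key qn.
elim: n s {qn} => [|n IH] s Os sq qs; first by move: qs; rewrite mul0r; lra.
have [<-|nsq] := eqVneq s q; first exact/(crel_modZ E)/modZ_refl.
have [d [dd con es]] := gap_step Os.
apply: (crel_trans E (es _ _ E eab)).
have [_ Osd _ _ gap] := con.
apply: IH => //; last by move: qs; rewrite -natr1 mulrDl mul1r; lra.
rewrite leNgt; apply/negP => qsd; apply: (gap q) => //.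
by rewrite lt_neqAle nsq.
Qed.

(** The integer m selects the lift of the gap for which a + m + 1 lies in
[theta, theta + 1/2]. *)
Lemma gap_of_consecutive theta : (forall t, on_orbit t -> half_arc theta t) ->
  exists m : int, rotational_gap theta (a + m%:~R) (b + m%:~R) k.
Proof.
move=> Oarc; have k0 := rlift_period O; have [Oa Ob _ _ gap] := ab.
have [t /modZP[m' tE] tt] := Oarc _ Oa.
pose m := (m' - 1)%R.
have mE : m%:~R = t - a - 1 :> R by rewrite /m intrB tE; lra.
exists m.
have con := consecutive_shift m ab.
have Oam : on_orbit (a + m%:~R) by case: con.
have Obm : on_orbit (b + m%:~R) by case: con.
split=> //.
- apply/andP; split; first by rewrite mE; lra.
  rewrite leNgt; apply/negP => lt.
  have [r rb rt] := Oarc _ Obm.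
  have rE : r = b + m%:~R by apply: (modZ_eq rb); move: long short; lra.
  by move: rt; rewrite rE; lra.
- by move: short; lra.
- by move: long; lra.
- by rewrite (_ : b + _ - _ = b - a) ?gap_length//; lra.
- exact: on_orbit_fix.
- exact: on_orbit_fix.
- move=> i r ik ri; have [i0 ik'] := andP ik.
  have [i1 iE] : exists i1, i = i1.+1 by exists i.-1; rewrite prednK.
  have i1k : (i1 < k)%N by rewrite iE in ik'; exact: ltnW.
  have [] := gap_image i1k; rewrite -iE => con2 _.
  have [s /modZP[p sE] bs] := gap_avoids ik con2.
  exists (s + 2 ^+ i * (r - m%:~R - a) + m%:~R).
    apply: modZ_trans (modZDint _ _) _.
    rewrite sE (_ : _ + _ = 2 ^+ i * (r - m%:~R) + p%:~R); last by ring.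
    apply: modZ_trans (modZDint _ _) _.
    apply: modZX.
    by rewrite -mulrNz; exact: modZDint.
  have p0 : 0 <= 2 ^+ i * (r - m%:~R - a).
    by rewrite mulr_ge0 ?exprn_ge0//; lra.
  have p1 : 2 ^+ i * (r - m%:~R - a) <= 2 ^+ i1 * (2 * (b - a) - 1).
    rewrite iE exprSr -mulrA ler_pM2l ?exprn_gt0//; lra.
  lra.
- move=> e E eab.
  have eab' : e a b.
    apply: (crel_trans E (crel_modZ E (modZ_sym (modZDint m _)))).
    exact: (crel_trans E eab (crel_modZ E (modZDint m _))).
  apply: (crel_trans E (crel_double E (crel_modZ E (modZDint m _)))).
  apply: (crel_trans E (orbit_chain E eab')).
  exact/(crel_modZ E)/modZ_sym/modZDint.
Qed.

End LongGap.

(** The end of the diameter that lies in the orbit bounds the long gap: the orbit lies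
in one closed half circle, and the adjacent gap contains the open other half. It is longer
than 1/2 because the doubling map is injective on the orbit. An orbit reduced to a
point has a full gap and is treated apart. *)
Lemma basic_rotational_total theta e : critical_relation theta e ->
  (forall t, on_orbit t -> half_arc theta t) ->
  on_orbit theta \/ on_orbit (theta - 2^-1) -> forall s t, e s t.
Proof.
move=> E Oarc.
have halves a b : on_orbit a -> on_orbit b -> b - a = 2^-1 -> False.
  move=> Oa Ob ba; have k0 := rlift_period O.
  have : a = b; last by lra.
  apply: modZ_eq; last by lra.
  apply: modZ_trans (modZ_sym (on_orbit_fix Oa)) _.
  apply: modZ_trans (on_orbit_fix Ob).
  rewrite (_ : b = a + 2^-1); last by lra.
  by apply: modZ_sym; exact: doubling_shift_half.
have ed := crel_diam E.
case=> [Ob|Oa].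
- have [a ab] := exists_predecessor Ob.
  have [Oa _ lt le gap] := ab.
  have [short|full] := ltP (theta - a) 1; last first.
    have aE : theta = a + 1 by lra.
    apply: (crel_total E ed); rewrite aE in ab.
    apply: (crel_trans E (t := 2 * a)).
      by rewrite aE; apply: (crel_modZ E); apply: modZ2; exact: (modZDint 1).
    apply: (crel_trans E (crel_modZ E (consecutive_full ab))).
    by rewrite aE; apply: (crel_modZ E); apply: modZ_sym; exact: (modZDint 1).
  have long : 2^-1 < theta - a.
    have [r ra rt] := Oarc _ Oa.
    have rE : r = a + 1.
      apply: modZ_eq; last by lra.
      by apply: modZ_trans ra (modZ_sym _); exact: (modZDint 1).
    rewrite lt_neqAle; apply/andP; split; last by lra.
    by apply/eqP => h; exact: (halves _ _ Oa Ob).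
  have [m G] := gap_of_consecutive ab long short Oarc.
  apply: (gap_total_end G E); left; apply: modZ_eq.
    by apply: modZ_sym; exact: modZDint.
  by have [h1 h2 h3 h4] := gap_bounds G; lra.
- have [b ab] := exists_successor Oa.
  have [_ Ob lt le gap] := ab.
  have [short|full] := ltP (b - (theta - 2^-1)) 1; last first.
    have bE : b = theta - 2^-1 + 1 by lra.
    rewrite bE in ab.
    apply: (crel_total E (p := theta - 2^-1)).
      apply: (crel_trans E (crel_sym E ed)); apply: (crel_modZ E).
      rewrite /modZ [X in X \is a _](_ : _ = 1) ?int_num1//; lra.
    exact: (crel_modZ E (consecutive_full ab)).
  have long : 2^-1 < b - (theta - 2^-1).
    have [r rb rt] := Oarc _ Ob.
    have rE : r = b by apply: (modZ_eq rb); lra.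
    rewrite lt_neqAle; apply/andP; split; last by lra.
    by apply/eqP => h; exact: (halves _ _ Oa Ob).
  have [m G] := gap_of_consecutive ab long short Oarc.
  apply: (gap_total_end G E); right; apply: modZ_eq.
    rewrite (_ : _ + 2^-1 = theta + m%:~R); last by lra.
    by apply: modZ_sym; exact: modZDint.
  by have [h1 h2 h3 h4] := gap_bounds G; lra.
Qed.

End RotationalOrbit.

(** * Crossing chords *)
Section ChordsCross.
Context {R : realType}.
Local Notation T := (circle R).
Implicit Types (r s t u : R).

Lemma disk_pt_toT t : disk_pt (toT t : T) = (cos (2 * pi * t), sin (2 * pi * t)).
Proof.
rewrite /disk_pt; have [m ->] := modZP (fracpart_modZ t).
have turns s (n : nat) : 2 * pi * (s + n%:R) = 2 * pi * s + (pi *+ 2) *+ n.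
  by rewrite -(mulr_natr (pi *+ 2)) -(mulr_natr pi); ring.
case: m => n.
  rewrite -[_%:~R]/(n%:R) turns.
  by rewrite (periodicn (@cosD2pi R)) (periodicn (@sinD2pi R)).
rewrite NegzE mulrNz -[_.+1%:~R]/(n.+1%:R); set s := t - _.
have -> : t = s + n.+1%:R by rewrite /s subrK.
by rewrite turns (periodicn (@cosD2pi R)) (periodicn (@sinD2pi R)).
Qed.

Lemma convex_hull_conv (S : set (R^o * R^o)) (p q : R^o * R^o) (l : R) :
  S p -> S q -> 0 <= l <= 1 -> convex_hull S (l *: p + (1 - l) *: q).
Proof.
move=> Sp Sq /andP[l0 l1] C [convC SC].
have := convC p q (Itv01 l0 l1); rewrite !inE.
by move=> /(_ (SC _ Sp) (SC _ Sq)).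
Qed.

(** In the frame with first axis through u, the chord from s to t meets this axis at a
point of abscissa c, with |c| <= 1; this point is on the diameter at u. *)
Lemma chords_cross (A B : set T) u s t : u < s < u + 2^-1 -> u + 2^-1 < t < u + 1 ->
  A (toT u) -> A (toT (u + 2^-1)) -> B (toT s) -> B (toT t) -> ~ unlinked A B.
Proof.
move=> us ut Au Au' Bs Bt AB.
pose U := 2 * pi * u; pose a := 2 * pi * (s - u); pose b := 2 * pi * (t - u - 2^-1).
have pi0 := @pi_gt0 R.
have sa : 0 < sin a by apply: sin_gt0_pi; rewrite /a; nra.
have sb : 0 < sin b by apply: sin_gt0_pi; rewrite /b; nra.
have sE : 2 * pi * s = a + U by rewrite /a /U; ring.
have uE : 2 * pi * (u + 2^-1) = U + pi.
  by rewrite /U mulrDr [2 * pi]mulrC -[pi * 2 / 2]mulrA divff ?mulr1// pnatr_eq0.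
have tE : 2 * pi * t = (b + U) + pi.
  have -> : t = (t - u - 2^-1) + (u + 2^-1) by ring.
  by rewrite mulrDr uE addrA.
(* a is the angle from u to s and b the angle from u + 1/2 to t. The weight l is the
   one for which the ordinates sin a and - sin b cancel. *)
pose l := sin b / (sin a + sin b).
have ab0 : 0 < sin a + sin b by exact: addr_gt0.
have l01 : 0 <= l <= 1.
  apply/andP; split; first by apply: divr_ge0; exact: ltW.
  by rewrite ler_pdivrMr// mul1r lerDr ltW.
have lE : l * sin a = (1 - l) * sin b.
  rewrite /l; field; exact: lt0r_neq0.
pose c := l * cos a - (1 - l) * cos b.
have c1 : -1 <= c <= 1.
  have := cos_geN1 a; have := cos_le1 a; have := cos_geN1 b; have := cos_le1 b.
  rewrite /c; move: l01; nra.
pose m := (1 + c) / 2.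
have m01 : 0 <= m <= 1 by rewrite /m; lra.
have H1 := convex_hull_conv (S := disk_pt @` A) (imageP disk_pt Au) (imageP disk_pt Au') m01.
have H2 := convex_hull_conv (S := disk_pt @` B) (imageP disk_pt Bs) (imageP disk_pt Bt) l01.
move: H1 H2; rewrite !disk_pt_toT sE uE tE -/U.
rewrite !cosDpi !sinDpi cosD sinD cosD sinD.
set z1 := (X in convex_hull _ X -> _) => H1.
set z2 := (X in convex_hull _ X -> _) => H2.
have zE : z1 = z2.
  rewrite /z1 /z2; congr (_, _); rewrite /= /GRing.scale /=.
  - have -> : m * cos U + (1 - m) * - cos U = c * cos U by rewrite /m; field.
    rewrite /c; move: lE; move: (cos a) (cos b) (sin a) (sin b) (cos U) (sin U) => ca cb sa' sb' cU sU lE.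
    have -> : l * (ca * cU - sa' * sU) + (1 - l) * - (cb * cU - sb' * sU) =
      (l * ca - (1 - l) * cb) * cU - (l * sa' - (1 - l) * sb') * sU by ring.
    by rewrite lE subrr mul0r subr0.
  - have -> : m * sin U + (1 - m) * - sin U = c * sin U by rewrite /m; field.
    rewrite /c; move: lE; move: (cos a) (cos b) (sin a) (sin b) (cos U) (sin U) => ca cb sa' sb' cU sU lE.
    have -> : l * (sa' * cU + ca * sU) + (1 - l) * - (sb' * cU + cb * sU) =
      (l * ca - (1 - l) * cb) * sU + (l * sa' - (1 - l) * sb') * cU by ring.
    by rewrite lE subrr mul0r addr0.
have : set0 z1 by rewrite -AB; split=> //; rewrite zE.
by [].
Qed.

End ChordsCross.

(** * From laminations to critical relations *)
Section LaminationRelation.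
Context {R : realType}.
Local Notation T := (circle R).

(** If 2s ~ 2t then s ~ t or s ~ t + 1/2, because the image of a class is a class. In
the second case, with s and t on the same side of the diameter, the chord from s to
t + 1/2 crosses it, so that s is in the class of the diameter; this class is
invariant under the half turn, hence contains t too. *)
Lemma lamination_critical_relation (lam : T -> set T) (theta : R) :
  is_lamination lam -> invariant_lamination lam ->
  lam (toT theta) (antipode (toT theta)) ->
  critical_relation theta (fun s t => lam (toT s) (toT t)).
Proof.
move=> [[lrefl lsym ltrans] lclosed _ lunl] linv; rewrite antipode_toT => ldiam.
pose e (s t : R) := lam (toT s) (toT t).
have leq s t : e s t -> lam (toT s) = lam (toT t).
  move=> st; apply/seteqP; split=> z; first exact: ltrans (lsym _ _ st).
  exact: ltrans st.
have em s t : modZ s t -> e s t by move=> /toT_eq; rewrite /e => ->.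
have es s t : e s t -> e t s by exact: lsym.
have et s t u : e s t -> e t u -> e s u by exact: ltrans.
have image x : sigma @` lam x = lam (sigma x).
  have [y yE] := linv x; rewrite yE; have : lam y (sigma x).
    by rewrite -yE; exists x => //; exact: lrefl.
  move=> yx; apply/seteqP; split=> z; first exact: ltrans (lsym _ _ yx).
  exact: ltrans yx.
have fwd s t : e s t -> e (2 * s) (2 * t).
  move=> st; rewrite /e -!sigma_toT -image; by exists (toT t).
have bwd s t : e (2 * s) (2 * t) -> e s t \/ e s (t + 2^-1).
  rewrite /e -(sigma_toT s) -image => -[y sy].
  have [r rE] := toT_surj y; rewrite -rE sigma_toT => /toT_eq /modZP[m mE].
  have rE' : r = t + m%:~R / 2 by lra.
  have [n [b nE]] : exists n : int, exists b : bool, m = (n * 2 + b%:Z)%R.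
    exists (m %/ 2)%Z, (m %% 2 != 0)%Z.
    rewrite {1}(divz_eq m 2); congr (_ + _)%R.
    have : (0 <= m %% 2 < 2)%Z by rewrite modz_ge0 //= ltz_pmod.
    by case: (m %% 2)%Z => [[|[|]]|].
  rewrite nE intrD intrM in rE'.
  case: b nE rE' => nE rE'; [right|left].
    rewrite (_ : toT (t + 2^-1) = toT r); first by rewrite rE.
    apply/toT_eq/modZ_sym; rewrite rE' -[true%:Z%:~R]/(1:R).
    rewrite (_ : t + _ = t + 2^-1 + n%:~R); [exact: modZDint|by field].
  rewrite (_ : toT t = toT r); first by rewrite rE.
  apply/toT_eq/modZ_sym; rewrite rE' -[false%:Z%:~R]/(0:R).
  rewrite (_ : t + _ = t + n%:~R); [exact: modZDint|by field].
have diam : e theta (theta - 2^-1).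
  apply: et ldiam _; apply: em; rewrite /modZ [X in X \is a _](_ : _ = 1) ?int_num1//.
  by lra.
split=> //.
  pose f (p : R * R) : T * T := (toT p.1, toT p.2).
  have cf : continuous f.
    move=> p.
    have c1 : (toT \o fst : R * R -> T) @ p --> (toT p.1 : T).
      by apply: continuous_comp; [exact: cvg_fst|exact: toT_continuous].
    have c2 : (toT \o snd : R * R -> T) @ p --> (toT p.2 : T).
      by apply: continuous_comp; [exact: cvg_snd|exact: toT_continuous].
    exact: (cvg_pair c1 c2).
  by apply: (@preimage_closed _ _ f _ _ lclosed) => p _; exact: cf.
move=> u s t hu us ut e2.
have uu : e u (u + 2^-1).
  case: hu => ->; first exact: ldiam.
  by rewrite subrK; exact: es.
case: (bwd s t e2) => // st.
have antip r : e r u -> e (r + 2^-1) u.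
  move=> ru; have : e (2 * (r + 2^-1)) (2 * u).
    apply: et (fwd _ _ ru); apply: em.
    by rewrite /modZ [X in X \is a _](_ : _ = 1) ?int_num1//; lra.
  move=> /bwd[//|h]; apply: et h _; exact: es.
have [su|nsu] := pselect (e s u).
  have tu : e (t + 2^-1) u by apply: (et _ _ _ _ su); exact: es.
  apply: (et _ _ _ su); apply: es; apply: (et _ _ _ _ (antip _ tu)); apply: em.
  by rewrite /modZ [X in X \is a _](_ : _ = - 1) ?rpredN ?int_num1//; lra.
have [s' ss' us'] := us; have [t' tt' ut'] := ut.
have ns' v : e v u -> s' <> v.
  by move=> vu sv; apply: nsu; apply: et vu; rewrite -sv; apply: em; exact: modZ_sym.
have nt' v : e v u -> t' + 2^-1 <> v.
  move=> vu tv; apply: nsu; apply: (et _ _ _ _ vu); rewrite -tv; apply: (et _ _ _ st); apply: em.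
  by apply: modZD (modZ_sym tt') (modZ_refl _).
have ru : e u u by exact/em/modZ_refl.
have h1 : u < s' by rewrite lt_neqAle; apply/andP; split; [apply/eqP => h; exact: (ns' u)|lra].
have h2 : s' < u + 2^-1.
  rewrite lt_neqAle; apply/andP; split; last by lra.
  by apply/eqP; apply: ns'; exact: es.
have h3 : u + 2^-1 < t' + 2^-1.
  rewrite lt_neqAle; apply/andP; split; last by lra.
  by rewrite eq_sym; apply/eqP; apply: nt'; exact: es.
have h4 : t' + 2^-1 < u + 1.
  rewrite lt_neqAle; apply/andP; split; last by lra.
  by apply/eqP; apply: nt'; apply: em; exact: (modZDint 1).
exfalso; have ne : lam (toT u) <> lam (toT s).
  by move=> us_; apply: nsu; apply: es; rewrite /e us_; exact: lrefl.
apply: (@chords_cross _ (lam (toT u)) (lam (toT s)) u s' (t' + 2^-1)) (lunl _ _ ne).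
- by rewrite h1.
- by rewrite h3.
- exact: lrefl.
- exact: uu.
- by apply: em; exact: modZ_sym.
- by apply: (et _ _ _ st); apply: em; apply: modZD (modZ_sym tt') (modZ_refl _).
Qed.

End LaminationRelation.

(** * Lifting the combinatorial data, and the induction *)
Section Lifting.
Context {R : realType}.
Local Notation T := (circle R).
Implicit Types (r s t u a b theta : R) (k : nat) (A : set T).

Lemma rotational_orbit_lift k A : rotational_orbit k A ->
  exists t0 H rho, rotational_lift k t0 H rho /\ forall t, A (toT t) <-> on_orbit t0 t.
Proof.
move=> [[x [k0 kx kmin AE]] [h [rho [[[F [_ Fm F1 Fh]] [g [hg _ _ _]]] _ hrot]]]].
have [t0 t0E] := toT_surj x; have [r rE] := toT_surj rho.
have orbE i : iter i sigma x = toT (2 ^+ i * t0) by rewrite -t0E iter_sigma_toT.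
have Fint := degree_one_int F1.
have Flt s t : s < t -> F s < F t.
  move=> st; rewrite lt_neqAle (Fm _ _ (ltW st)) andbT; apply/eqP => Fst.
  have : toT s = toT t :> T by apply: (can_inj hg); rewrite -!Fh Fst.
  move=> /toT_eq/modZP[m sE]; move: Fst; rewrite sE Fint; lra.
exists t0, F, r; split.
  split=> //.
  - by apply/toT_eq; rewrite -iter_sigma_toT t0E.
  - by move=> j jk /toT_eq; rewrite -iter_sigma_toT t0E; exact: kmin.
  - exact/leW_mono/le_mono.
  - move=> i; apply/toT_eq; rewrite toTD !Fh rE -!orbE iterS.
    by apply: hrot; rewrite AE; exists i.
move=> t; rewrite AE; split=> [[i _]|[i ti]].
  by rewrite orbE => /toT_eq ti; exists i; exact: modZ_sym.
by exists i => //; rewrite orbE; apply/toT_eq; exact: modZ_sym.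
Qed.

(** If a were not in A, a segment from a to an inner point of the component would be
connected in the complement of A, so a would be in the component. *)
Lemma component_ends a b A : a <= b < a + 1 ->
  is_component (arc_oo (toT a) (toT b)) (~` A) ->
  [/\ A (toT a), A (toT b) & forall u, a < u -> u < b -> ~ A (toT u)].
Proof.
move=> ab [x Ax arcE].
have arcP r : connected_component (~` A) x (toT r) <-> exists2 r', modZ r' r & a < r' < b.
  by rewrite -arcE; exact: arc_oo_toT.
have avoid u : a < u -> u < b -> ~ A (toT u).
  move=> au ub; have : connected_component (~` A) x (toT u).
    by apply/arcP; exists u; [exact: modZ_refl|rewrite au].
  exact: connected_component_sub.
have [y yx] := toT_surj x.
have [x0 x0y x0ab] : exists2 r', modZ r' y & a < r' < b.
  by apply/arcP; rewrite yx; exact: connected_component_refl.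
have x0x : toT x0 = x by rewrite -yx; exact/toT_eq.
have segment s t : s <= x0 <= t -> (forall u, s <= u <= t -> ~ A (toT u)) ->
    forall u, s <= u <= t -> exists2 r', modZ r' u & a < r' < b.
  move=> sxt stA u ust; apply/arcP.
  have C : connected ((toT : R -> T) @` `[s, t]).
    apply: connected_continuous_connected; first exact: segment_connected.
    by apply: continuous_subspaceT; exact: toT_continuous.
  apply: (connected_component_max _ _ C).
  - by exists x0 => //; rewrite /= in_itv.
  - by move=> _ [v /= vst <-]; apply: stA; rewrite in_itv in vst.
  - by exists u => //; rewrite /= in_itv.
split=> //.
- apply: contrapT => nA.
  have [r ra rab] : exists2 r', modZ r' a & a < r' < b.
    apply: (segment a x0); [lra| |lra].
    move=> u; rewrite le_eqVlt => /andP[/orP[/eqP <- // |au] ux]; apply: avoid => //; lra.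
  have : r = a by apply: (modZ_eq ra); lra.
  lra.
- apply: contrapT => nA.
  have [r ra rab] : exists2 r', modZ r' b & a < r' < b.
    apply: (segment x0 b); [lra| |lra].
    move=> u /andP[xu]; rewrite le_eqVlt => /orP[/eqP -> // |ub]; apply: avoid => //; lra.
  have : r = b by apply: (modZ_eq ra); lra.
  lra.
Qed.

Lemma is_A_half_arc theta k A : is_A (toT theta) k A ->
  forall t, A (toT t) -> half_arc theta t.
Proof. by move=> [_ Aarc] t /Aarc/arc_cc_half_arc. Qed.

Lemma basic_rotational_critical theta e : basic_rotational (toT theta : T) ->
  critical_relation theta e -> forall s t, e s t.
Proof.
move=> [k [A [isA Ath]]] E.
have [t0 [H [rho [lift AE]]]] := rotational_orbit_lift (proj1 isA).
apply: (basic_rotational_total lift E).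
  by move=> t /AE; exact: is_A_half_arc isA t.
case: Ath => [/AE|]; first by left.
rewrite antipode_toT => /AE Oth; right; apply: on_orbit_modZ Oth.
by rewrite /modZ [X in X \is a _](_ : _ = 1) ?int_num1//; lra.
Qed.

Lemma horseshoe_data_gap theta k (a' b' : T) : horseshoe_data (toT theta) k a' b' ->
  exists a b, [/\ rotational_gap theta a b k, toT a = a', toT b = b' &
    theta = b \/ theta = a + 2^-1 -> basic_rotational (toT theta : T)].
Proof.
move=> [_ [A [isA comp long]]].
have [a aE] := toT_surj a'; have [b0 b0E] := toT_surj b'.
have [b bb0 ab] := modZ_fundamental a b0.
have bE : toT b = b' by rewrite -b0E; exact/toT_eq.
move: long comp; rewrite -aE -bE (arclen_toT ab) => long comp.
have [Aa Ab avoid] := component_ends ab comp.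
have [t0 [H [rho [lift AE]]]] := rotational_orbit_lift (proj1 isA).
have con : consecutive t0 a b.
  split; [exact/AE|exact/AE|lra|lra|].
  by move=> u /AE Au au ub; exact: avoid Au.
have short : b - a < 1 by lra.
have arc t : on_orbit t0 t -> half_arc theta t by move=> /AE /(is_A_half_arc isA).
have [m G] := gap_of_consecutive lift con long short arc.
have am : toT (a + m%:~R) = toT a :> T by apply/toT_eq; exact: modZDint.
have bm : toT (b + m%:~R) = toT b :> T by apply/toT_eq; exact: modZDint.
exists (a + m%:~R), (b + m%:~R); split=> // h; exists k, A; split=> //.
case: h => thE; first by left; rewrite thE bm.
right; rewrite antipode_toT thE.
rewrite (_ : toT _ = toT a) //; apply/toT_eq.
rewrite (_ : _ + _ = a + (m + 1)%:~R); first exact: modZDint.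
by rewrite intrD; lra.
Qed.

Lemma horseshoe_toT theta a b k t : rotational_gap theta a b k ->
  horseshoe k (toT a : T) (toT b) (toT t) <-> in_horseshoe a b k t.
Proof.
move=> G; have [h1 h2 h3 h4] := gap_bounds G.
have branchP r : (arc_cc (antipode (toT a)) (toT b) `|` arc_cc (toT a) (antipode (toT b)))
    (toT r : T) <-> exists2 r', modZ r' r & in_branches a b r'.
  have -> : antipode (toT b) = toT (b - 2^-1) :> T.
    rewrite antipode_toT; apply/toT_eq.
    by rewrite /modZ [X in X \is a _](_ : _ = 1) ?int_num1//; lra.
  rewrite antipode_toT; split=> [[]|[r' rr' [br|br]]].
  - by move=> /arc_cc_toT[|r' rr' br]; [lra|exists r' => //; right].
  - by move=> /arc_cc_toT[|r' rr' br]; [lra|exists r' => //; left].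
  - by right; apply/arc_cc_toT; [lra|exists r'].
  - by left; apply/arc_cc_toT; [lra|exists r'].
rewrite /horseshoe /=; split=> Dt.
- move=> i r rt; have := Dt i; rewrite iter_sigma_toT => /branchP[r' r't br].
  by apply: (in_branches_gaps G br); exact: modZ_trans rt (modZ_sym r't).
- move=> i; rewrite iter_sigma_toT; apply/branchP.
  have Di : in_horseshoe a b k (2 ^+ (k * i) * t).
    elim: i => [|i IH]; first by rewrite muln0 expr0 mul1r.
    by rewrite mulnS exprD -mulrA; exact: in_horseshoe_expand.
  have [s si sab] := in_horseshoe_lift Di.
  exists s => //; apply: in_horseshoe_branches => //.
  exact: in_horseshoe_modZ (modZ_sym si) Di.
Qed.

Lemma pruning_has_lift theta a b k (phi : T -> T) : rotational_gap theta a b k ->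
  is_pruning k (toT a) (toT b) phi ->
  exists2 F, pruning_lift a b k F & forall t, toT (F t) = phi (toT t).
Proof.
move=> G [[F [Fc Fm F1 Fphi]] _ phi_onto phi_conj [phib phia phia' phib']].
have Fint := degree_one_int F1.
exists F => //; split=> //.
- by rewrite -[F a]subr0; apply/toT_eq; rewrite Fphi phia toT0.
- by rewrite -[F b]subr0; apply/toT_eq; rewrite Fphi phib toT0.
- by apply/toT_eq; rewrite Fphi -antipode_toT phia'.
- apply/toT_eq; rewrite Fphi -[RHS]/(half_pt : T) -phib' antipode_toT; congr (phi _); apply/toT_eq.
  by rewrite /modZ [X in X \is a _](_ : _ = - 1) ?rpredN ?int_num1//; lra.
- move=> t Dt; apply/toT_eq; rewrite Fphi -sigma_toT Fphi -iter_sigma_toT.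
  by apply: phi_conj; apply/(horseshoe_toT _ G).
- move=> s; have : [set: T] (toT s) by [].
  rewrite -phi_onto => -[x Dx]; have [t tE] := toT_surj x.
  move: Dx; rewrite -tE => /(horseshoe_toT _ G) Dt; rewrite -Fphi.
  move=> /toT_eq/modZ_sym/modZP[m sE]; exists (t + m%:~R); last by rewrite Fint.
  exact: in_horseshoe_modZ (modZ_sym (modZDint _ _)) Dt.
Qed.

(** The induction is on the number of renormalizations, for all lifts of theta and all
critical relations at once, since both change at each step. *)
Lemma snowflake_total n (x : T) : snowflake n x ->
  forall theta e, toT theta = x -> critical_relation theta e -> forall s t, e s t.
Proof.
elim=> {n x} [x rot|n x eta nrot nnonrot [k [a' [b' [phi [data prun _ etaE]]]]] _ IH] theta e thx E.
  by rewrite -thx in rot; exact: basic_rotational_critical E.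
rewrite -thx in data nrot nnonrot etaE.
have [a [b [G aE bE ends]]] := horseshoe_data_gap data.
rewrite -aE -bE in prun; have [F PF Fphi] := pruning_has_lift G prun.
have ne_b : theta <> b by move=> h; apply: nrot; apply: ends; left.
have ne_a : theta <> a + 2^-1 by move=> h; apply: nrot; apply: ends; right.
have [h1 h2 h3 h4] := gap_bounds G.
have Dth : in_horseshoe a b k theta.
  have : horseshoe k a' b' (toT theta) \/ horseshoe k a' b' (antipode (toT theta)).
    apply: contrapT => h; apply: nnonrot; exists k, a', b'.
    by split=> // hh; apply: h; [left|right].
  rewrite antipode_toT -aE -bE => -[/(horseshoe_toT _ G)//|/(horseshoe_toT _ G) D].
  apply: (in_horseshoe_antipode G (s := theta - 2^-1)); first by right; lra.
    apply: in_horseshoe_modZ D.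
    by rewrite /modZ [X in X \is a _](_ : _ = 1) ?int_num1//; lra.
  by right; lra.
apply: (pruned_total G PF E Dth).
have E' := pruned_critical_relation G PF E Dth ne_b ne_a.
case: etaE => etaE; first by apply: (IH (F theta)) => //; rewrite Fphi.
apply: (IH (F theta + 2^-1)); last exact: crel_antipode.
rewrite etaE antipode_toT -Fphi; apply/toT_eq.
have -> : theta + 2^-1 = theta - 2^-1 + 1 by lra.
rewrite (plift_degree PF) (plift_antitheta G PF Dth ne_b ne_a).
by rewrite (_ : _ - _ + 1 = F theta + 2^-1); [exact: modZ_refl|lra].
Qed.

End Lifting.

Theorem theorem6p6 (R : realType) (theta : circle R)
    (theta_range : fracpart theta < 2^-1)
    (theta_periodic : periodic_pt (sigma theta))
    (theta_snowflake : exists n : nat, snowflake n theta) :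
  ~ exists lam : circle R -> set (circle R),
      [/\ is_lamination lam, invariant_lamination lam,
          ~ degenerate_lamination lam & lam theta (antipode theta)].
Proof.
move=> [lam [islam inv nondeg diam]]; apply: nondeg => x y.
have [n snow] := theta_snowflake.
have [t tE] := toT_surj theta; rewrite -tE in diam.
have [s <-] := toT_surj x; have [u <-] := toT_surj y.
exact: (snowflake_total snow tE (lamination_critical_relation islam inv diam)).
Qed.
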